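(* Assume that $f,g$ satisfy the regularity condition and the dissipativity condition stated in the context, and let $R>0$. Then for any $\epsilon_{10},\epsilon_{11}>0$ and $k\in\mathbb{N}$ there exists $\Delta_4>0$ such that for every step size $\Delta=\tau/M\in(0,\Delta_4]$ and every $\xi\in B(R)$, $$\mathbb{P}\big\{\|X_{t_k}^{0,\xi}-x_{t_k}^{0,\xi}\|>\epsilon_{10}\big\}<\epsilon_{11}.$$
   Context: Setting. $|\cdot|$ is the Euclidean norm on $\mathbb{R}^d$ and the trace norm on $\mathbb{R}^{d\times m}$. Let $\tau>0$, $\mathcal{C}=C([-\tau,0];\mathbb{R}^d)$ with supremum norm $\|X\|=\sup_{-\tau\le\theta\le0}|X(\theta)|$, and $B(R)=\{X\in\mathcal{C}:\|X\|\le R\}$ for $R>0$. $W$ is an $m$-dimensional Brownian motion on a filtered probability space $(\Omega,\mathcal{F},\mathbb{P})$ with the usual conditions. $f:\mathbb{R}^d\times\mathbb{R}^d\to\mathbb{R}^d$ and $g:\mathbb{R}^d\times\mathbb{R}^d\to\mathbb{R}^{d\times m}$ are Borel measurable, and $x(t)=x(t;0,\xi)$, $t\ge-\tau$, denotes the solution of $dx(t)=f(x(t),x(t-\tau))dt+g(x(t),x(t-\tau))dW(t)$, $t>0$, with initial data $x(\theta)=\xi(\theta)$, $\theta\in[-\tau,0]$ (under the conditions below it exists globally and is unique). Its segment at time $t\ge0$ is $x_t^{0,\xi}=\{x(t+\theta;0,\xi):-\tau\le\theta\le0\}\in\mathcal{C}$. Regularity condition. There are constants $q\ge2$ and $a_1,\dots,a_9,\epsilon_1,\epsilon_2\ge0$,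 and functions $g_1,g_2:\mathbb{R}^d\to\mathbb{R}^{d\times m}$ such that, with $V(x,y)=|x-y|^2(|x|^{q-1}+|y|^{q-1})$, for all $x,\bar x,y,\bar y\in\mathbb{R}^d$: $|f(x,y)-f(\bar x,\bar y)|\le a_1(1+|x|^{q-1}+|\bar x|^{q-1}+|y|^{q-1}+|\bar y|^{q-1})(|x-\bar x|+|y-\bar y|)$; $|g(x,y)-g(\bar x,\bar y)|^2\le\epsilon_1|g_1(x)-g_1(\bar x)|^2+\epsilon_2|g_2(y)-g_2(\bar y)|^2$; $\epsilon_1|g_1(x)-g_1(\bar x)|^2\le a_2|x-\bar x|^2+a_4V(x,\bar x)$; $\epsilon_2|g_2(y)-g_2(\bar y)|^2\le a_3|y-\bar y|^2+a_5V(y,\bar y)$; $|f(x,y)|\le a_6(1+|x|^q+|y|^q)$; $|g(x,y)|^2\le a_7+a_8|x|^{q+1}+a_9|y|^{q+1}$. Dissipativity condition. With the same $q,a_i,V$ and $p^*=4q-2$, there are nonnegative constants $b_1,\dots,b_{13},l_1,l_2$ with $b_1>b_2+l_1(a_2+a_3)$, $b_3>l_1(a_4+a_5)$, $b_5>b_6$, $b_7>b_8$, $b_{10}>b_{11}$, $b_{12}>b_{13}$, $l_1>2$, $l_2>1$, such that for all $x,\bar x,y,\bar y\in\mathbb{R}^d$: $2\langle x-\bar x,f(x,y)-f(\bar x,\bar y)\rangle\le-b_1|x-\bar x|^2+b_2|y-\bar y|^2-b_3V(x,\bar x)$; $\frac{p^*}{2}|x|^{p^*-2}\big(2\langle x,f(x,y)\rangle+(p^*-1)|g(x,y)|^2\big)\le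 b_4-b_5|x|^{p^*}+b_6|y|^{p^*}-b_7|x|^{p^*+q-1}+b_8|y|^{p^*+q-1}$; $2\langle x,f(x,y)\rangle+l_2|g(x,y)|^2\le b_9-b_{10}|x|^2+b_{11}|y|^2-b_{12}|x|^{q+1}+b_{13}|y|^{q+1}$. Backward Euler-Maruyama (BEM) method. Step sizes are $\Delta=\tau/M$ with $M$ a positive integer, $t_k=k\Delta$ for $k\ge-M$. Put $X_k=\xi(t_k)$ for $k=-M,\dots,0$ and, for $k\ge1$, $X_k=X_{k-1}+f(X_k,X_{k-M})\Delta+g(X_{k-1},X_{k-M-1})\Delta W_{k-1}$, where $\Delta W_{k-1}=W(k\Delta)-W((k-1)\Delta)$ (this implicit scheme is well defined). The continuous approximation is $X(t)=X(t;0,\xi)=\xi(t)$ for $t\in[-\tau,0]$ and $X(t)=X_k+\theta(X_{k+1}-X_k)$ for $t\ge0$, with $k=\lfloor t/\Delta\rfloor$, $\theta=t/\Delta-k$. The numerical segment at time $t\ge0$ is $X_t^{0,\xi}=\{X(t+\theta;0,\xi):-\tau\le\theta\le0\}\in\mathcal{C}$. *)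

(* Defs.v *)
From HB Require Import structures.
From mathcomp Require Import all_boot all_order all_algebra.
From mathcomp Require Import all_classical all_reals all_analysis.

Set Implicit Arguments.
Unset Strict Implicit.
Unset Printing Implicit Defensive.

Import Order.TTheory GRing.Theory Num.Theory.
Import numFieldNormedType.Exports.

Local Open Scope classical_set_scope.
Local Open Scope ring_scope.

(* The canonical norm of MathComp-Analysis on matrices is the max norm, hence
   this one: the Euclidean norm on column vectors, and the trace
   (Hilbert-Schmidt) norm sqrt (tr (A^T A)) on matrices. *)
Definition enorm (R : realType) (m n : nat) (A : 'M[R]_(m, n)) : R :=
  Num.sqrt (\sum_(i < m) \sum_(j < n) A i j ^+ 2).

Definition inner (R : realType) (d : nat) (x y : 'cV[R]_d) : R :=
  \sum_(i < d) x i 0 * y i 0.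

(* Supremum norm of a path on [-tau, 0]; it takes its values in \bar R so that
   no boundedness proof is needed. *)
Definition sup_norm (R : realType) (d : nat) (tau : R) (y : R -> 'cV[R]_d) :
    \bar R :=
  ereal_sup [set (enorm (y th))%:E | th in `[- tau, 0]].

Definition segment (R : realType) (d : nat) (y : R -> 'cV[R]_d) (t : R) :
    R -> 'cV[R]_d :=
  fun th => y (t + th).

(* The set B(r) of C([-tau, 0]; R^d); elements of this space are represented by
   functions on R, of which only the values on [-tau, 0] matter. *)
Definition sup_ball (R : realType) (d : nat) (tau r : R) :
    set (R -> 'cV[R]_d) :=
  [set xi | {within `[- tau, 0], continuous xi} /\
            (sup_norm tau xi <= r%:E)%E].

Definition borel_measurable (T U : topologicalType) (h : T -> U) : Prop :=
  forall A : set U, <<s open >> A -> <<s open >> (h @^-1` A).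

Section Coefficients.
Variables (R : realType) (d m : nat).
Variables (f : 'cV[R]_d -> 'cV[R]_d -> 'cV[R]_d).
Variables (g : 'cV[R]_d -> 'cV[R]_d -> 'M[R]_(d, m)).

Definition Vfun (q : R) (x y : 'cV[R]_d) : R :=
  enorm (x - y) ^+ 2 * (enorm x `^ (q - 1) + enorm y `^ (q - 1)).

Record regularity (q a1 a2 a3 a4 a5 a6 a7 a8 a9 e1 e2 : R)
    (g1 g2 : 'cV[R]_d -> 'M[R]_(d, m)) : Prop := Regularity {
  reg_q : 2 <= q;
  reg_a_ge0 : [/\ [/\ 0 <= a1, 0 <= a2 & 0 <= a3],
                  [/\ 0 <= a4, 0 <= a5 & 0 <= a6]
                & [/\ 0 <= a7, 0 <= a8 & 0 <= a9]];
  reg_e_ge0 : 0 <= e1 /\ 0 <= e2;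
  reg_f : forall x x' y y' : 'cV[R]_d,
    enorm (f x y - f x' y') <=
      a1 * (1 + enorm x `^ (q - 1) + enorm x' `^ (q - 1)
              + enorm y `^ (q - 1) + enorm y' `^ (q - 1))
         * (enorm (x - x') + enorm (y - y'));
  reg_g : forall x x' y y' : 'cV[R]_d,
    enorm (g x y - g x' y') ^+ 2 <=
      e1 * enorm (g1 x - g1 x') ^+ 2 + e2 * enorm (g2 y - g2 y') ^+ 2;
  reg_g1 : forall x x' : 'cV[R]_d,
    e1 * enorm (g1 x - g1 x') ^+ 2 <=
      a2 * enorm (x - x') ^+ 2 + a4 * Vfun q x x';
  reg_g2 : forall y y' : 'cV[R]_d,
    e2 * enorm (g2 y - g2 y') ^+ 2 <=
      a3 * enorm (y - y') ^+ 2 + a5 * Vfun q y y';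
  reg_f_growth : forall x y : 'cV[R]_d,
    enorm (f x y) <= a6 * (1 + enorm x `^ q + enorm y `^ q);
  reg_g_growth : forall x y : 'cV[R]_d,
    enorm (g x y) ^+ 2 <=
      a7 + a8 * enorm x `^ (q + 1) + a9 * enorm y `^ (q + 1)
}.

Record dissipativity (q a2 a3 a4 a5 : R)
    (b1 b2 b3 b4 b5 b6 b7 b8 b9 b10 b11 b12 b13 l1 l2 : R) : Prop :=
    Dissipativity {
  dis_b_ge0 : [/\ [/\ 0 <= b1, 0 <= b2, 0 <= b3 & 0 <= b4],
                  [/\ 0 <= b5, 0 <= b6, 0 <= b7 & 0 <= b8],
                  [/\ 0 <= b9, 0 <= b10, 0 <= b11 & 0 <= b12]
                & 0 <= b13];
  dis_l_ge0 : 0 <= l1 /\ 0 <= l2;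
  dis_b12 : b2 + l1 * (a2 + a3) < b1;
  dis_b3 : l1 * (a4 + a5) < b3;
  dis_b56 : b6 < b5;
  dis_b78 : b8 < b7;
  dis_b1011 : b11 < b10;
  dis_b1213 : b13 < b12;
  dis_l1 : 2 < l1;
  dis_l2 : 1 < l2;
  dis_f : forall x x' y y' : 'cV[R]_d,
    2 * inner (x - x') (f x y - f x' y') <=
      - b1 * enorm (x - x') ^+ 2 + b2 * enorm (y - y') ^+ 2
      - b3 * Vfun q x x';
  dis_pstar : let p := 4 * q - 2 in forall x y : 'cV[R]_d,
    p / 2 * enorm x `^ (p - 2)
      * (2 * inner x (f x y) + (p - 1) * enorm (g x y) ^+ 2) <=
      b4 - b5 * enorm x `^ p + b6 * enorm y `^ p
      - b7 * enorm x `^ (p + q - 1) + b8 * enorm y `^ (p + q - 1);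
  dis_two : forall x y : 'cV[R]_d,
    2 * inner x (f x y) + l2 * enorm (g x y) ^+ 2 <=
      b9 - b10 * enorm x ^+ 2 + b11 * enorm y ^+ 2
      - b12 * enorm x `^ (q + 1) + b13 * enorm y `^ (q + 1)
}.

End Coefficients.

(* Z is measurable with respect to the sigma-algebra G on Om. *)
Definition mx_measurable (R : realType) (Om : Type) (G : set (set Om))
    (p n : nat) (Z : Om -> 'M[R]_(p, n)) : Prop :=
  forall i j (A : set R), measurable A -> G [set w | A (Z w i j)].

Section Stochastic.
Variables (R : realType) (dO : measure_display) (Om : measurableType dO).
Variable P : probability Om R.
(* Time indices are reals of which only the nonnegative ones are meaningful. *)
Variable F : R -> set (set Om).

Record usual_filtration : Prop := UsualFiltration {
  filt_sigma : forall t : R, 0 <= t -> sigma_algebra setT (F t);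
  filt_sub : forall t : R, 0 <= t -> F t `<=` measurable;
  filt_mono : forall s t : R, 0 <= s -> s <= t -> F s `<=` F t;
  filt_right : forall t : R, 0 <= t -> F t = \bigcap_(s in [set s | t < s]) F s;
  filt_complete : forall N : set Om, P.-negligible N -> F 0 N
}.

Definition adapted (p n : nat) (H : R -> Om -> 'M[R]_(p, n)) : Prop :=
  forall t : R, 0 <= t -> mx_measurable (F t) (H t).

Definition progressive (p n : nat) (H : R -> Om -> 'M[R]_(p, n)) : Prop :=
  forall t : R, 0 <= t -> forall i j (A : set R), measurable A ->
    <<s [set D : set (R * Om) |
          exists B C, [/\ measurable B, F t C & D = B `*` C]] >>
      [set sw | 0 <= sw.1 <= t /\ A (H sw.1 sw.2 i j)].

(* bm_indep and bm_law are stated on Borel rectangles of R^m, which form a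
   generating pi-system: W t - W s is independent of F s and its law is
   N(0, (t - s) I_m).  The second parameter of normal_prob is the standard
   deviation. *)
Record brownian_motion (m : nat) (W : R -> Om -> 'cV[R]_m) : Prop :=
    BrownianMotion {
  bm_adapted : adapted W;
  bm_zero : {ae P, forall w, W 0 w = 0};
  bm_continuous : {ae P, forall w, {within `[0, +oo[, continuous (W ^~ w)}};
  bm_indep : forall s t : R, 0 <= s -> s < t ->
    forall (B : set Om) (A : 'I_m -> set R),
      F s B -> (forall j, measurable (A j)) ->
      let E := [set w | forall j, A j ((W t w - W s w) j 0)] in
      P (B `&` E) = (P B * P E)%E;
  bm_law : forall s t : R, 0 <= s -> s < t ->
    forall A : 'I_m -> set R, (forall j, measurable (A j)) ->
      P [set w | forall j, A j ((W t w - W s w) j 0)] =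
      (\big[mule/1]_(j < m) normal_prob 0 (Num.sqrt (t - s)) (A j))%E
}.

(* The simple process equal to sp_coef i on (sp_time i, sp_time i.+1] for
   i < sp_size, and to 0 elsewhere. *)
Record simple_process (d m : nat) := SimpleProcess {
  sp_size : nat;
  sp_time : nat -> R;
  sp_coef : nat -> Om -> 'M[R]_(d, m);
  sp_time0 : 0 <= sp_time 0%N;
  sp_time_le : forall i, (i < sp_size)%N -> sp_time i <= sp_time i.+1;
  sp_coef_meas : forall i, (i < sp_size)%N ->
    mx_measurable (F (sp_time i)) (sp_coef i);
  sp_coef_bounded : exists C : R, forall i w, (i < sp_size)%N ->
    enorm (sp_coef i w) <= C
}.

Definition sp_val (d m : nat) (S : simple_process d m) (s : R) (w : Om) :
    'M[R]_(d, m) :=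
  \sum_(i < sp_size S)
    (sp_time S i < s <= sp_time S i.+1)%R%:R *: sp_coef S i w.

Definition sp_integral (d m : nat) (W : R -> Om -> 'cV[R]_m)
    (S : simple_process d m) (t : R) (w : Om) : 'cV[R]_d :=
  \sum_(i < sp_size S)
    sp_coef S i w *m (W (Num.min (sp_time S i.+1) t) w
                      - W (Num.min (sp_time S i) t) w).

(* The Lebesgue integral over [0, T] of the squared trace norm. *)
Definition sq_int (d m : nat) (H : R -> Om -> 'M[R]_(d, m)) (T : R) (w : Om) :
    \bar R :=
  (\int[lebesgue_measure]_(s in `[0%R, T]) (enorm (H s w) ^+ 2)%:E)%E.

(* I is (a version of) the Ito integral process of H with respect to the
   Brownian motion W: the limit, uniformly on compacts in probability, of the
   integrals of simple processes approximating H in L^2([0, T]) in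
   probability.  This determines I up to indistinguishability. *)
Record ito_integral (d m : nat) (W : R -> Om -> 'cV[R]_m)
    (H : R -> Om -> 'M[R]_(d, m)) (I : R -> Om -> 'cV[R]_d) : Prop :=
    ItoIntegral {
  ito_progressive : progressive H;
  ito_sq_int : {ae P, forall w, forall T : R, 0 <= T -> (sq_int H T w < +oo)%E};
  ito_continuous : {ae P, forall w, {within `[0, +oo[, continuous (I ^~ w)}};
  ito_approx : exists S : nat -> simple_process d m,
    forall T eps : R, 0 <= T -> 0 < eps ->
      (P [set w | (eps%:E <
                   sq_int (fun s w' => (sp_val (S n) s w' - H s w')%R) T w)%E]
         @[n --> \oo] --> 0%E) /\
      (P [set w | (eps%:E <
                   ereal_sup [set (enorm (sp_integral W (S n) t w - I t w)%R)%:E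
                             | t in `[0%R, T]])%E]
         @[n --> \oo] --> 0%E)
}.

Section Equation.
Variables (d m : nat) (W : R -> Om -> 'cV[R]_m) (tau : R).
Variables (f : 'cV[R]_d -> 'cV[R]_d -> 'cV[R]_d).
Variables (g : 'cV[R]_d -> 'cV[R]_d -> 'M[R]_(d, m)).
Variable xi : R -> 'cV[R]_d.

(* x is the solution of dx(t) = f(x(t), x(t-tau)) dt + g(x(t), x(t-tau)) dW(t)
   with initial data xi on [-tau, 0]. *)
Record sdde_solution (x : R -> Om -> 'cV[R]_d) : Prop := SddeSolution {
  sol_continuous :
    forall w, {within `[- tau, +oo[, continuous (x ^~ w)};
  sol_adapted : adapted x;
  sol_initial : forall (th : R) w, - tau <= th <= 0 -> x th w = xi th;
  sol_drift_int : {ae P, forall w, forall (T : R) (i : 'I_d), 0 <= T ->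
    lebesgue_measure.-integrable `[0, T]
      (fun s => (f (x s w) (x (s - tau) w) i 0)%:E)};
  sol_eq : exists I : R -> Om -> 'cV[R]_d,
    ito_integral W (fun s w => g (x s w) (x (s - tau) w)) I /\
    {ae P, forall w, forall t : R, 0 <= t ->
      x t w = xi 0
        + (\col_(i < d) (\int[lebesgue_measure]_(s in `[0, t])
                           (f (x s w) (x (s - tau) w) i 0)))
        + I t w}
}.

(* Backward Euler-Maruyama scheme with step Delta = tau / M; only the indices
   k >= - M are meaningful. *)
Record bem_scheme (M : nat) (X : int -> Om -> 'cV[R]_d) : Prop := BemScheme {
  bem_initial : forall (k : int) w, - (M%:Z) <= k <= 0 ->
    X k w = xi (k%:~R * (tau / M%:R));
  bem_step : forall (k : int) w, 1 <= k ->
    let Delta := tau / M%:R in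
    X k w = X (k - 1) w
      + Delta *: f (X k w) (X (k - M%:Z) w)
      + g (X (k - 1) w) (X (k - M%:Z - 1) w)
          *m (W (k%:~R * Delta) w - W ((k - 1)%:~R * Delta) w)
}.

Definition bem_interp (M : nat) (X : int -> Om -> 'cV[R]_d) (t : R) (w : Om) :
    'cV[R]_d :=
  let Delta := tau / M%:R in
  let k := Num.floor (t / Delta) in
  let th := t / Delta - k%:~R in
  if t <= 0 then xi t else X k w + th *: (X (k + 1) w - X k w).

End Equation.
End Stochastic.

(* Main.v *)
Require Import Defs.
From HB Require Import structures.
From mathcomp Require Import all_boot all_order all_algebra.
From mathcomp Require Import all_classical all_reals all_analysis.
From mathcomp Require Import measurable_realfun.
From mathcomp Require Import lra ring.

Set Implicit Arguments.
Unset Strict Implicit.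
Unset Printing Implicit Defensive.

Import Order.TTheory GRing.Theory Num.Theory.
Import numFieldNormedType.Exports.

Local Open Scope classical_set_scope.
Local Open Scope ring_scope.

(** The number k of steps is fixed before the step size D = tau / M is chosen,
    so the time t_k = k D tends to 0 with D, and for k <= M every delayed
    argument met up to t_k is a value of the initial path.  On [- tau, 0] the
    numerical and the exact path coincide.  On [0, t_k] each of them stays close
    to xi 0 with high probability, uniformly over initial paths bounded by r, and
    the triangle inequality through xi 0 concludes.

    The exact solution (solution_stays).  Until the solution first leaves the
    eps-ball around xi 0 its coefficients are bounded by constants that depend
    on r and eps only (path_continuous_hitting, locally_lipschitz_bounded).  At
    that exit time the drift has contributed at most a constant times t, so the
    stochastic integral must have reached size about eps although the integral
    of its squared integrand is at most a constant times t.  By a maximal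
    inequality of Lenglart's type (ito_maximal_inequality) this has probability
    at most a constant times t / eps ^ 2.

    The maximal inequality is built in three stages.  In discrete time
    (disc_maximal_inequality) increments are switched off once the bracket would
    exceed its bound or the integral has left a ball; the switched integral has
    a second moment controlled by the bracket and Markov's inequality applies.
    The second-moment computation rests on the independence of Brownian
    increments from the past (indep_ge0_integralM, indep_increment_mean0).
    Refining the time grid and using the continuity of Brownian paths extends
    the bound to simple processes at all times (sp_maximal_inequality), and the
    defining approximation of the stochastic integral by simple processes
    carries it over to the integral itself.  Since probabilities are meaningful
    on measurable events only, all events involved are shown to be measurable,
    by joint measurability in time and outcome or by continuity of paths.

    The numerical scheme (bem_stays).  The drift is monotone in its first
    argument, so the implicit step is the inverse of an expansive map
    (implicit_step_nonexpansive).  Hence each step moves the scheme by at most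
    D |f| + |g| |dW|, with f and g evaluated at the beginning of the step, and k
    such moves add up to little when D and the k Brownian increments are small.
    The same nonexpansiveness makes X_j a continuous functional of measurable
    data, whence its measurability. *)

(** * The Euclidean norm *)

Section EuclideanNorm.
Variable R : realType.

Lemma sum_cauchy_schwarz (I : finType) (a b : I -> R) :
  (\sum_i a i * b i) ^+ 2 <= (\sum_i a i ^+ 2) * (\sum_i b i ^+ 2).
Proof.
set S := \sum_i a i * b i; set A := \sum_i a i ^+ 2; set B := \sum_i b i ^+ 2.
have B0 : 0 <= B by apply: sumr_ge0 => i _; exact: sqr_ge0.
have : 0 <= \sum_i (B * a i - S * b i) ^+ 2.
  by apply: sumr_ge0 => i _; exact: sqr_ge0.
have -> : \sum_i (B * a i - S * b i) ^+ 2 = B * (A * B - S ^+ 2).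
  rewrite (eq_bigr (fun i => B ^+ 2 * a i ^+ 2 - (B * S *+ 2) * (a i * b i)
    + S ^+ 2 * b i ^+ 2)); last by move=> i _; ring.
  by rewrite big_split/= sumrB -!mulr_sumr -/A -/B -/S; ring.
have [B_gt0|] := ltP 0 B; first by rewrite pmulr_rge0// subr_ge0.
move=> B_le0 _; have B_eq0 : B = 0 by apply/le_anti; rewrite B_le0 B0.
have b0 i : b i = 0.
  have /eqP := B_eq0; rewrite psumr_eq0; last by move=> j _; exact: sqr_ge0.
  by move=> /allP /(_ i); rewrite mem_index_enum sqrf_eq0 => /(_ isT)/eqP.
by rewrite /S big1 ?B_eq0 ?mulr0 ?expr0n// => i _; rewrite b0 mulr0.
Qed.

Lemma enorm_ge0 p n (A : 'M[R]_(p, n)) : 0 <= enorm A.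
Proof. exact: sqrtr_ge0. Qed.

Lemma enorm_sqr p n (A : 'M[R]_(p, n)) :
  enorm A ^+ 2 = \sum_i \sum_j A i j ^+ 2.
Proof.
by rewrite sqr_sqrtr// sumr_ge0// => i _; apply: sumr_ge0 => j _; exact: sqr_ge0.
Qed.

Lemma enorm_sqr_cV n (x : 'cV[R]_n) : enorm x ^+ 2 = \sum_i x i 0 ^+ 2.
Proof. by rewrite enorm_sqr; apply: eq_bigr => i _; rewrite big_ord1. Qed.

Lemma enorm_le p n (A : 'M[R]_(p, n)) (c : R) :
  0 <= c -> (enorm A <= c) = (enorm A ^+ 2 <= c ^+ 2).
Proof. by move=> c0; rewrite ler_sqr// nnegrE enorm_ge0. Qed.

Lemma enorm0 p n : enorm (0 : 'M[R]_(p, n)) = 0.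
Proof.
by rewrite /enorm big1 ?sqrtr0// => i _; rewrite big1// => j _; rewrite mxE expr0n.
Qed.

Lemma enormZ p n (a : R) (A : 'M[R]_(p, n)) : enorm (a *: A) = `|a| * enorm A.
Proof.
rewrite -sqrtr_sqr /enorm -sqrtrM ?sqr_ge0//; congr Num.sqrt.
rewrite mulr_sumr; apply: eq_bigr => i _.
by rewrite mulr_sumr; apply: eq_bigr => j _; rewrite mxE exprMn.
Qed.

Lemma enormN p n (A : 'M[R]_(p, n)) : enorm (- A) = enorm A.
Proof. by rewrite -scaleN1r enormZ normrN1 mul1r. Qed.

Lemma enorm_distrC p n (A B : 'M[R]_(p, n)) : enorm (A - B) = enorm (B - A).
Proof. by rewrite -enormN opprB. Qed.

Lemma inner_enorm n (x : 'cV[R]_n) : inner x x = enorm x ^+ 2.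
Proof. by rewrite enorm_sqr_cV; apply: eq_bigr => i _; rewrite expr2. Qed.

Lemma inner_le n (x y : 'cV[R]_n) : inner x y <= enorm x * enorm y.
Proof.
apply: le_trans (ler_norm _) _.
rewrite -ler_sqr ?nnegrE ?mulr_ge0 ?enorm_ge0// real_normK ?num_real//.
by rewrite exprMn !enorm_sqr_cV; exact: sum_cauchy_schwarz.
Qed.

Lemma innerDr n (x y z : 'cV[R]_n) : inner x (y + z) = inner x y + inner x z.
Proof. by rewrite -big_split/=; apply: eq_bigr => i _; rewrite mxE mulrDr. Qed.

Lemma innerZr n a (x y : 'cV[R]_n) : inner x (a *: y) = a * inner x y.
Proof. by rewrite mulr_sumr; apply: eq_bigr => i _; rewrite mxE; ring. Qed.

Lemma enormD p n (A B : 'M[R]_(p, n)) : enorm (A + B) <= enorm A + enorm B.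
Proof.
rewrite enorm_le ?addr_ge0 ?enorm_ge0// sqrrD.
have -> : enorm (A + B) ^+ 2 = enorm A ^+ 2 +
    (\sum_(ij : 'I_p * 'I_n) A ij.1 ij.2 * B ij.1 ij.2) *+ 2 + enorm B ^+ 2.
  rewrite !enorm_sqr !pair_bigA/= -sumrMnl -!big_split/=.
  by apply: eq_bigr => ij _; rewrite mxE sqrrD.
rewrite lerD2r lerD2l lerMn2r/=; apply: le_trans (ler_norm _) _.
rewrite -ler_sqr ?nnegrE ?mulr_ge0 ?enorm_ge0// real_normK ?num_real//.
by rewrite exprMn !enorm_sqr !pair_bigA; exact: sum_cauchy_schwarz.
Qed.

Lemma enorm_le_trans p n (A B C : 'M[R]_(p, n)) :
  enorm (A - C) <= enorm (A - B) + enorm (B - C).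
Proof. by have := enormD (A - B) (B - C); rewrite addrA subrK. Qed.

Lemma ler_enorm_dist p n (A B : 'M[R]_(p, n)) :
  `|enorm A - enorm B| <= enorm (A - B).
Proof.
rewrite ler_norml; apply/andP; split.
  by rewrite lerNl opprB enorm_distrC lerBlDr -{1}(subrK A B) enormD.
by rewrite lerBlDr -{1}(subrK B A) enormD.
Qed.

Lemma enormD_sqr p n (A B : 'M[R]_(p, n)) :
  enorm (A + B) ^+ 2 <= 2 * enorm A ^+ 2 + 2 * enorm B ^+ 2.
Proof.
have := enormD A B; rewrite enorm_le ?addr_ge0 ?enorm_ge0// => /le_trans; apply.
by have := sqr_ge0 (enorm A - enorm B); nra.
Qed.

Lemma enorm_mulmx_sqr p n (A : 'M[R]_(p, n)) (v : 'cV[R]_n) :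
  enorm (A *m v) ^+ 2 <= enorm A ^+ 2 * enorm v ^+ 2.
Proof.
rewrite (enorm_sqr_cV v) enorm_sqr_cV enorm_sqr mulr_suml.
by apply: ler_sum => i _; rewrite mxE; exact: sum_cauchy_schwarz.
Qed.

Lemma enorm_mulmx p n (A : 'M[R]_(p, n)) (v : 'cV[R]_n) :
  enorm (A *m v) <= enorm A * enorm v.
Proof.
by rewrite enorm_le ?mulr_ge0 ?enorm_ge0// exprMn; exact: enorm_mulmx_sqr.
Qed.

Lemma le_coord_enorm p n (A : 'M[R]_(p, n)) i j : `|A i j| <= enorm A.
Proof.
rewrite -ler_sqr ?nnegrE ?enorm_ge0// real_normK ?num_real// enorm_sqr.
rewrite (bigD1 i)//= (bigD1 j)//= -addrA lerDl addr_ge0//.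
  by apply: sumr_ge0 => *; exact: sqr_ge0.
by apply: sumr_ge0 => k _; apply: sumr_ge0 => *; exact: sqr_ge0.
Qed.

Lemma enorm_mx_norm p n (A : 'M[R]_(p, n)) (c : R) : 0 <= c ->
  (forall i j, `|A i j| <= c) -> enorm A <= (p * n)%:R * c.
Proof.
move=> c0 Ac; rewrite enorm_le ?mulr_ge0// enorm_sqr.
apply: (@le_trans _ _ (\sum_(i < p) \sum_(j < n) c ^+ 2)).
  apply: ler_sum => i _; apply: ler_sum => j _.
  by rewrite -real_normK ?num_real// ler_sqr ?nnegrE.
under eq_bigr do rewrite sumr_const card_ord.
rewrite sumr_const card_ord -mulrnA mulnC -[leLHS]mulr_natl exprMn.
rewrite ler_wpM2r ?sqr_ge0// -natrX ler_nat.
by case: (p * n)%N => // k; rewrite -mulnn leq_pmulr.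
Qed.

End EuclideanNorm.

(** * Second moments of centred Gaussian increments *)

Section Gaussian.
Variable R : realType.
Local Notation mu := (@lebesgue_measure R).

(** The normal density is a Radon-Nikodym derivative of the normal law, and
    such derivatives are unique almost everywhere. *)
Lemma ge0_integral_normal_prob (s : R) (h : R -> \bar R) :
  measurable_fun setT h -> (forall x, 0 <= h x)%E ->
  (\int[normal_prob 0 s]_x h x = \int[mu]_x (h x * (normal_pdf 0 s x)%:E))%E.
Proof.
move=> mh h0.
have dom := normal_prob_dominates 0 s.
rewrite -(Radon_Nikodym_SigmaFinite.change_of_variables dom)//.
have mpdf : measurable_fun setT (fun x => (normal_pdf 0 s x)%:E).
  by apply/measurable_EFinP; exact: measurable_normal_pdf.
have iRN := Radon_Nikodym_SigmaFinite.f_integrable dom.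
have aeE : ae_eq mu setT
    (Radon_Nikodym_SigmaFinite.f (normal_prob 0 s) mu)
    (fun x => (normal_pdf 0 s x)%:E).
  apply: integral_ae_eq => // A _ mA.
  by rewrite -(Radon_Nikodym_SigmaFinite.f_integral dom).
apply: ge0_ae_eq_integral => //.
- by apply: emeasurable_funM => //; exact: measurable_int iRN.
- exact: emeasurable_funM.
- by move=> x _; rewrite mule_ge0// Radon_Nikodym_SigmaFinite.f_ge0.
- by move=> x _; rewrite mule_ge0// lee_fin normal_pdf_ge0.
- by apply: filterS aeE => x /= + _ => ->.
Qed.

(** The quadratic weight is absorbed by doubling the variance: y e^(- y) <= 1
    applied to y = x ^ 2 / (4 s ^ 2). *)
Lemma normal_pdf_sqr_le (s x : R) : 0 < s ->
  x ^+ 2 * normal_pdf 0 s x <=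
  8 * s ^+ 2 * normal_pdf 0 (Num.sqrt 2 * s) x.
Proof.
move=> s0; have s20 : 0 < s ^+ 2 by rewrite exprn_gt0.
have r2 : Num.sqrt 2 ^+ 2 = 2 :> R by rewrite sqr_sqrtr.
have r20 : 0 < Num.sqrt 2 :> R by rewrite sqrtr_gt0.
rewrite !normal_pdfE ?mulf_neq0 ?gt_eqF//.
have peakE : normal_peak s = Num.sqrt 2 * normal_peak (Num.sqrt 2 * s).
  rewrite /normal_peak exprMn r2.
  have -> : (2 * s ^+ 2 * pi *+ 2) = 2 * (s ^+ 2 * pi *+ 2) :> R by ring.
  by rewrite sqrtrM// invfM mulrA divff ?mul1r// gt_eqF.
set pk := normal_peak (Num.sqrt 2 * s) in peakE *.
have pk0 : 0 <= pk by exact: normal_peak_ge0.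
rewrite peakE /normal_fun !subr0 exprMn r2.
set y := x ^+ 2 / (4 * s ^+ 2).
have y0 : 0 <= y by apply: divr_ge0; [exact: sqr_ge0|lra].
have -> : - x ^+ 2 / (s ^+ 2 *+ 2) = - y - y.
  by rewrite /y; field; rewrite gt_eqF.
have -> : - x ^+ 2 / ((2 * s ^+ 2) *+ 2) = - y.
  by rewrite /y; field; rewrite gt_eqF.
have -> : x ^+ 2 = 4 * s ^+ 2 * y by rewrite /y; field; rewrite gt_eqF.
rewrite expRD.
have ye1 : y * expR (- y) <= 1.
  rewrite expRN ler_pdivrMr ?expR_gt0// mul1r.
  by apply: le_trans (expR_ge1Dx y); rewrite lerDr.
have sqrt2_le2 : Num.sqrt 2 <= 2 :> R.
  by rewrite -ler_sqr ?nnegrE// r2 expr2 -natrM ler_nat.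
have -> : 4 * s ^+ 2 * y * (Num.sqrt 2 * pk * (expR (- y) * expR (- y))) =
  (4 * s ^+ 2 * pk * expR (- y)) * (Num.sqrt 2 * (y * expR (- y))) by ring.
have -> : 8 * s ^+ 2 * (pk * expR (- y)) =
  (4 * s ^+ 2 * pk * expR (- y)) * 2 by ring.
apply: ler_wpM2l; first by rewrite !mulr_ge0 ?expR_ge0 ?(ltW s0).
by rewrite -[leRHS]mulr1 ler_pM// mulr_ge0// expR_ge0.
Qed.

(** The constant 8 is not optimal; only the order s ^ 2 matters. *)
Lemma normal_second_moment (s : R) : 0 < s ->
  (\int[normal_prob 0 s]_x ((x ^+ 2)%:E) <= (8 * s ^+ 2)%:E)%E.
Proof.
move=> s0.
have msqr : measurable_fun [set: R] (fun x : R => (x ^+ 2)%:E).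
  by apply/measurable_EFinP; exact: measurable_funX.
rewrite ge0_integral_normal_prob//; last first.
  by move=> x; rewrite lee_fin sqr_ge0.
have mpdf t : measurable_fun setT (fun x : R => (normal_pdf 0 t x)%:E).
  by apply/measurable_EFinP; exact: measurable_normal_pdf.
apply: (@le_trans _ _ (\int[mu]_x ((8 * s ^+ 2)%:E *
    (normal_pdf 0 (Num.sqrt 2 * s) x)%:E))%E).
  apply: ge0_le_integral => //.
  - by move=> x _; rewrite mule_ge0// lee_fin ?sqr_ge0// normal_pdf_ge0.
  - by apply: emeasurable_funM => //; exact: mpdf.
  - by apply: emeasurable_funM => //; exact: mpdf.
  - by move=> x _; rewrite -!EFinM lee_fin; exact: normal_pdf_sqr_le.
rewrite ge0_integralZl//=.
- by rewrite integral_normal_pdf mule1.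
- exact: mpdf.
- by move=> x _; rewrite lee_fin normal_pdf_ge0.
- by rewrite lee_fin mulr_ge0// sqr_ge0.
Qed.

Lemma normal_probN (s : R) (A : set R) : s != 0 -> measurable A ->
  normal_prob 0 s (-%R @^-1` A) = normal_prob 0 s A.
Proof.
move=> s0 mA.
have mopp : measurable_fun setT 
      (-%R : measurableTypeR R -> measurableTypeR R).
  exact: oppr_measurable.
have mpdf : measurable_fun setT (fun x : R => (normal_pdf 0 s x)%:E).
  by apply/measurable_EFinP; exact: measurable_normal_pdf.
have evenE x : normal_pdf 0 s (- x) = normal_pdf 0 s x.
  by rewrite !normal_pdfE// /normal_fun !subr0 sqrrN.
rewrite /normal_prob; under [LHS]eq_integral do rewrite -evenE.
rewrite -(@ge0_integral_pushforward _ _ _ _ _ _ mopp _ A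
  (fun x => (normal_pdf 0 s x)%:E))//.
- by apply: eq_measure_integral => B mB _; exact: lebesgue_measureN.
- exact: measurable_funTS.
- by move=> x _; rewrite lee_fin normal_pdf_ge0.
Qed.

End Gaussian.

(** * Independence from the past *)

Section Independence.
Context d (Om : measurableType d) (R : realType) (P : probability Om R).
Variables (Z : Om -> R) (U : Om -> measurableTypeR R).
Variable nu : probability (measurableTypeR R) R.
Hypotheses (mZ : measurable_fun setT Z) (mU : measurable_fun setT U).
Hypothesis indep : forall A B : set R, measurable A -> measurable B ->
  P (Z @^-1` A `&` U @^-1` B) = (P (Z @^-1` A) * nu B)%E.

Let mZU : measurable_fun setT (fun w => (Z w, U w)).
Proof. exact: measurable_fun_pair. Qed.

Let mZf := isMeasurableFun.Build _ _ _ _ Z mZ.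
Let Zf : {RV P >-> R} := HB.pack Z mZf.
Let mZUf := isMeasurableFun.Build _ _ _ _ (fun w => (Z w, U w)) mZU.
Let ZUf : {RV P >-> (R * measurableTypeR R)%type} :=
  HB.pack (fun w => (Z w, U w)) mZUf.

(** Independence says that the joint law agrees with the product measure on
    rectangles, which determine it. *)
Lemma indep_joint_law (X : set (R * measurableTypeR R)) : measurable X ->
  distribution P ZUf X = (distribution P Zf \x nu)%E X.
Proof.
by move=> mX; symmetry; apply: product_measure_unique.
Qed.

Lemma indep_integral (h : R * measurableTypeR R -> \bar R) :
  measurable_fun setT h -> P.-integrable setT (fun w => h (Z w, U w)) ->
  (\int[P]_w h (Z w, U w) = \int[distribution P Zf \x nu]_x h x)%E.
Proof.
move=> mh ih; rewrite -[LHS](integral_distribution (X := ZUf) mh ih).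
by apply: eq_measure_integral => A mA _; exact: indep_joint_law.
Qed.

Lemma indep_ge0_integralM (h : R -> \bar R)
    (k : measurableTypeR R -> \bar R) :
  measurable_fun setT h -> measurable_fun setT k ->
  (forall x, 0 <= h x)%E -> (forall x, 0 <= k x)%E ->
  (\int[P]_w (h (Z w) * k (U w)) =
   (\int[P]_w h (Z w)) * \int[nu]_x k x)%E.
Proof.
move=> mh mk h0 k0.
have mhk : measurable_fun setT
    (fun xy : R * measurableTypeR R => (h xy.1 * k xy.2)%E).
  by apply: emeasurable_funM; [exact: measurableT_comp|exact: measurableT_comp].
rewrite -[LHS](ge0_integral_distribution ZUf mhk); last first.
  by move=> xy; rewrite mule_ge0.
rewrite (eq_measure_integral (distribution P Zf \x nu)%E); last first.
  by move=> A mA _; exact: indep_joint_law.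
rewrite fubini_tonelli1//=; last by move=> x; rewrite mule_ge0.
rewrite /fubini_F/=; under eq_integral do rewrite ge0_integralZl//.
rewrite ge0_integralZr//; last by apply: integral_ge0.
by congr (_ * _)%E; exact: ge0_integral_distribution.
Qed.

End Independence.

Section GaussianIncrement.
Context d (Om : measurableType d) (R : realType) (P : probability Om R).
Variables (Z U : Om -> R) (s : R).
Hypotheses (mZ : measurable_fun setT Z) (mU : measurable_fun setT U).
Hypothesis s_gt0 : 0 < s.
Hypothesis indep : forall A B : set R, measurable A -> measurable B ->
  P (Z @^-1` A `&` U @^-1` B) = (P (Z @^-1` A) * normal_prob 0 s B)%E.

Lemma indep_increment_sqr_le : (forall w, 0 <= Z w) ->
  (\int[P]_w (Z w * U w ^+ 2)%:E <= (8 * s ^+ 2)%:E * \int[P]_w (Z w)%:E)%E.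
Proof.
move=> Z0; pose h (x : R) : \bar R := `|x|%:E.
pose k (x : R) : \bar R := (x ^+ 2)%:E.
have mh : measurable_fun setT h.
  by apply/measurable_EFinP; exact: normr_measurable.
have mk : measurable_fun setT k.
  by apply/measurable_EFinP; exact: measurable_funX.
have h0 x : (0 <= h x)%E by rewrite lee_fin.
have k0 x : (0 <= k x)%E by rewrite lee_fin sqr_ge0.
have hZ w : h (Z w) = (Z w)%:E by rewrite /h ger0_norm.
under eq_integral do rewrite EFinM -hZ -/(k _).
under [X in (_ <= _ * X)%E]eq_integral do rewrite -hZ.
rewrite (indep_ge0_integralM mZ mU indep)// muleC.
apply: lee_pmul => //; try exact: normal_second_moment; exact: integral_ge0.
Qed.

(** Domination by C (1 + U ^ 2). *)
Lemma integrable_bounded_sqr (C : R) : (forall w, `|Z w| <= C) ->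
  P.-integrable setT (fun w => (U w ^+ 2)%:E) ->
  P.-integrable setT (fun w => (Z w * U w)%:E).
Proof.
move=> ZC iU.
have C0 : 0 <= C by apply: le_trans (ZC point).
have iC : P.-integrable setT (fun w => (C + C * U w ^+ 2)%:E).
  have -> : (fun w => (C + C * U w ^+ 2)%:E) =
      (cst C%:E \+ (fun w => C%:E * (U w ^+ 2)%:E))%E.
    by apply/funext => w; rewrite /= EFinD EFinM.
  apply: integrableD => //; last exact: integrableZl.
  exact: finite_measure_integrable_cst.
apply: le_integrable iC => //.
  by apply/measurable_EFinP; exact: measurable_funM.
move=> w _; rewrite !abse_EFin lee_fin normrM.
rewrite [leRHS]ger0_norm; last by rewrite addr_ge0// mulr_ge0// sqr_ge0.
have -> : C + C * U w ^+ 2 = C * (1 + U w ^+ 2) by ring.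
apply: ler_pM => //.
rewrite -(real_normK (num_real (U w))); set a := `|U w|.
by have := sqr_ge0 (a - 1); nra.
Qed.

(** Both (Z, U) and (Z, - U) have the product law, so the mean of the product
    equals its own opposite. *)
Lemma indep_increment_mean0 : P.-integrable setT (fun w => (Z w * U w)%:E) ->
  (\int[P]_w (Z w * U w)%:E = 0)%E.
Proof.
move=> iZU.
have mV : measurable_fun setT (fun w => - U w).
  by apply: measurableT_comp mU; exact: oppr_measurable.
have indepV (A B : set R) : measurable A -> measurable B ->
    P (Z @^-1` A `&` (fun w => - U w) @^-1` B) =
    (P (Z @^-1` A) * normal_prob 0 s B)%E.
  move=> mA mB; rewrite -(normal_probN (lt0r_neq0 s_gt0))// -indep//.
  by rewrite -[X in measurable X]setTI; exact: oppr_measurable.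
have mM : measurable_fun setT
    (fun xy : R * measurableTypeR R => (xy.1 * xy.2)%:E).
  by apply/measurable_EFinP; exact: measurable_funM.
have iZV : P.-integrable setT (fun w => (Z w * - U w)%:E).
  have -> : (fun w => (Z w * - U w)%:E) = (fun w => - (Z w * U w)%:E)%E.
    by apply/funext => w; rewrite mulrN EFinN.
  exact: integrableN.
have E : (\int[P]_w (Z w * U w)%:E = \int[P]_w (Z w * - U w)%:E)%E.
  rewrite (indep_integral mZ mU indep mM iZU).
  by rewrite (indep_integral mZ mV indepV mM iZV).
move: E; under [X in _ = X -> _]eq_integral do rewrite mulrN EFinN.
rewrite integralN//; last exact: integrable_add_def.
have := integrable_fin_num measurableT iZU.
move: (\int[P]_w (Z w * U w)%:E)%E => -[a| |]//= _ [] aN.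
by congr EFin; lra.
Qed.

End GaussianIncrement.

(** * Measurable random matrices and the filtration *)

Section MatrixMeasurability.
Context d (T : measurableType d) (R : realType).

Definition mxmeas p n (Z : T -> 'M[R]_(p, n)) : Prop :=
  forall i j, measurable_fun setT (fun w => Z w i j).

Lemma mxmeas_cst p n (A : 'M[R]_(p, n)) : mxmeas (fun=> A).
Proof. by move=> i j; exact: measurable_cst. Qed.

Lemma mxmeasD p n (Y Z : T -> 'M[R]_(p, n)) :
  mxmeas Y -> mxmeas Z -> mxmeas (fun w => Y w + Z w).
Proof.
by move=> mY mZ i j; under eq_fun do rewrite mxE; exact: measurable_funD.
Qed.

Lemma mxmeasB p n (Y Z : T -> 'M[R]_(p, n)) :
  mxmeas Y -> mxmeas Z -> mxmeas (fun w => Y w - Z w).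
Proof.
by move=> mY mZ i j; under eq_fun do rewrite !mxE; exact: measurable_funB.
Qed.

Lemma mxmeasZ p n (a : T -> R) (Z : T -> 'M[R]_(p, n)) :
  measurable_fun setT a -> mxmeas Z -> mxmeas (fun w => a w *: Z w).
Proof.
by move=> ma mZ i j; under eq_fun do rewrite mxE; exact: measurable_funM.
Qed.

Lemma mxmeas_sum p n (I : Type) (s : seq I) (Z : I -> T -> 'M[R]_(p, n)) :
  (forall i, mxmeas (Z i)) -> mxmeas (fun w => \sum_(i <- s) Z i w).
Proof.
move=> mZ i j; under eq_fun do rewrite summxE.
by apply: measurable_sum => k; exact: mZ.
Qed.

Lemma mxmeasM p n k (Y : T -> 'M[R]_(p, n)) (Z : T -> 'M[R]_(n, k)) :
  mxmeas Y -> mxmeas Z -> mxmeas (fun w => Y w *m Z w).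
Proof.
move=> mY mZ i j; under eq_fun do rewrite mxE.
by apply: measurable_sum => l; exact: measurable_funM.
Qed.

Lemma measurable_enorm_sqr p n (Z : T -> 'M[R]_(p, n)) :
  mxmeas Z -> measurable_fun setT (fun w => enorm (Z w) ^+ 2).
Proof.
move=> mZ; under eq_fun do rewrite enorm_sqr.
apply: measurable_sum => i; apply: measurable_sum => j.
exact: measurable_funX.
Qed.

Lemma measurable_enorm p n (Z : T -> 'M[R]_(p, n)) :
  mxmeas Z -> measurable_fun setT (fun w => enorm (Z w)).
Proof.
move=> mZ; have E w : enorm (Z w) = Num.sqrt (enorm (Z w) ^+ 2).
  by rewrite sqrtr_sqr ger0_norm ?enorm_ge0.
under eq_fun do rewrite E.
apply: (@measurableT_comp _ _ _ _ _ _ (@Num.sqrt R)).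
  by apply: continuous_measurable_fun; exact: sqrt_continuous.
exact: measurable_enorm_sqr.
Qed.

Lemma measurable_enorm_gt p n (Z : T -> 'M[R]_(p, n)) (a : R) :
  mxmeas Z -> measurable [set w | a < enorm (Z w)].
Proof.
move=> mZ; rewrite -[X in measurable X]setTI.
have -> : [set w | a < enorm (Z w)] = (fun w => enorm (Z w)) @^-1` `]a, +oo[.
  by apply/seteqP; split => w /=; rewrite in_itv/= andbT.
by apply: measurable_enorm => //.
Qed.

End MatrixMeasurability.

Section Filtration.
Context (R : realType) dO (Om : measurableType dO) (P : probability Om R).
Variable F : R -> set (set Om).
Hypothesis filtF : usual_filtration P F.

(** The set of events F t regarded as a measurable space, so that measurability
    with respect to the past is an instance of the ambient notion. *)
Definition past (t : R) := g_sigma_algebraType (F t).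

Lemma past_measurable t : 0 <= t -> @measurable _ (past t) = F t.
Proof.
by move=> t0; apply: sigma_algebra_id; exact: (filt_sigma filtF).
Qed.

Lemma measurable_fun_past t (Z : Om -> R) : 0 <= t ->
  (measurable_fun setT (Z : past t -> R) <->
   forall A, measurable A -> F t [set w | A (Z w)]).
Proof.
move=> t0; split=> [mZ A mA|FZ _ A mA].
  by rewrite -(past_measurable t0) -[X in measurable X]setTI; exact: mZ.
by rewrite setTI past_measurable//; exact: FZ.
Qed.

Lemma past_mono s t d' (T : measurableType d') (Z : Om -> T) :
  0 <= s -> s <= t ->
  measurable_fun setT (Z : past s -> T) ->
  measurable_fun setT (Z : past t -> T).
Proof.
move=> s0 st mZ _ A mA; rewrite past_measurable//; last exact: le_trans st.
apply: (filt_mono filtF s0 st); rewrite -(past_measurable s0).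
exact: mZ.
Qed.

Lemma past_ambient t d' (T : measurableType d') (Z : Om -> T) : 0 <= t ->
  measurable_fun setT (Z : past t -> T) -> measurable_fun setT Z.
Proof.
move=> t0 mZ _ A mA; apply: (filt_sub filtF t0).
by rewrite -(past_measurable t0); exact: mZ.
Qed.

Lemma mxmeas_past t p n (Z : Om -> 'M[R]_(p, n)) : 0 <= t ->
  mx_measurable (F t) Z -> mxmeas (Z : past t -> 'M[R]_(p, n)).
Proof.
by move=> t0 mZ i j; apply/(measurable_fun_past _ t0) => A mA; exact: mZ.
Qed.

Lemma mxmeas_past_mono s t p n (Z : Om -> 'M[R]_(p, n)) :
  0 <= s -> s <= t ->
  mxmeas (Z : past s -> 'M[R]_(p, n)) -> mxmeas (Z : past t -> 'M[R]_(p, n)).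
Proof. by move=> s0 st mZ i j; exact: past_mono (mZ i j). Qed.

Lemma mxmeas_past_ambient t p n (Z : Om -> 'M[R]_(p, n)) : 0 <= t ->
  mxmeas (Z : past t -> 'M[R]_(p, n)) -> mxmeas Z.
Proof. by move=> t0 mZ i j; exact: past_ambient (mZ i j). Qed.

(** The filtration contains the null sets, so the ambient sigma-algebra is
    complete. *)
Lemma negligible_measurable (N : set Om) : P.-negligible N -> measurable N.
Proof.
by move=> N0; apply: (filt_sub filtF (lexx 0)); exact: (filt_complete filtF).
Qed.

(** Completeness again: an event may be altered on a null set. *)
Lemma measurable_ae_eq (A B N : set Om) : P.-negligible N ->
  measurable A -> (forall w, ~ N w -> (A w <-> B w)) -> measurable B.
Proof.
move=> N0 mA AB.
have mN := negligible_measurable N0.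
have mBN : measurable (B `&` N).
  by apply: negligible_measurable; apply: negligibleS N0; exact: subIsetr.
have -> : B = (A `\` N) `|` (B `&` N).
  apply/seteqP; split => w.
    move=> Bw; have [Nw|Nw] := pselect (N w); [by right|].
    by left; split => //; apply/AB.
  by case=> [[Aw Nw]|[]//]; apply/AB.
by apply: measurableU => //; exact: measurableD.
Qed.

End Filtration.

(** * A maximal inequality for discrete stochastic integrals *)

Section BrownianIncrements.
Context (R : realType) dO (Om : measurableType dO) (P : probability Om R).
Variable F : R -> set (set Om).
Variables (m : nat) (W : R -> Om -> 'cV[R]_m).
Hypothesis filtF : usual_filtration P F.
Hypothesis bmW : brownian_motion P F W.

Lemma bm_mxmeas_past s t : 0 <= s -> s <= t ->
  mxmeas (W s : past F t -> 'cV[R]_m).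
Proof.
move=> s0 st; apply: (mxmeas_past_mono filtF s0 st).
by apply: (mxmeas_past filtF s0); exact: (bm_adapted bmW).
Qed.

Lemma bm_mxmeas s : 0 <= s -> mxmeas (W s).
Proof.
by move=> s0; apply: (mxmeas_past_ambient filtF s0); exact: bm_mxmeas_past.
Qed.

(* One coordinate of the increment is a rectangle with all other sides full. *)
Let coord_rect (j : 'I_m) (B : set R) (k : 'I_m) : set R :=
  if k == j then B else setT.

Let coord_rectE s t j B :
  [set w | forall k, coord_rect j B k ((W t w - W s w) k 0)] =
  [set w | B ((W t w - W s w) j 0)].
Proof.
apply/seteqP; split => w /=.
  by move=> /(_ j); rewrite /coord_rect eqxx.
by move=> Bw k; rewrite /coord_rect; case: eqP => // ->.
Qed.

Lemma bm_increment_law s t j (B : set R) :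
  0 <= s -> s < t -> measurable B ->
  P [set w | B ((W t w - W s w) j 0)] = normal_prob 0 (Num.sqrt (t - s)) B.
Proof.
move=> s0 st mB; rewrite -coord_rectE (bm_law bmW)//; last first.
  by move=> k; rewrite /coord_rect; case: ifP.
rewrite (bigD1 j)//= {1}/coord_rect eqxx big1 ?mule1// => k kj.
by rewrite /coord_rect (negbTE kj); exact: probability_setT.
Qed.

Lemma bm_increment_indep s t j (C : set Om) (B : set R) :
  0 <= s -> s < t -> F s C -> measurable B ->
  P (C `&` [set w | B ((W t w - W s w) j 0)]) =
  (P C * normal_prob 0 (Num.sqrt (t - s)) B)%E.
Proof.
move=> s0 st FC mB; rewrite -(bm_increment_law j s0 st mB) -coord_rectE.
apply: (bm_indep bmW s0 st FC) => k.
by rewrite /coord_rect; case: ifP.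
Qed.

Section Moments.
Variables (s t : R) (j : 'I_m) (Z : Om -> R).
Hypotheses (s0 : 0 <= s) (st : s < t).
Hypothesis mZ : measurable_fun setT (Z : past F s -> R).

Local Notation U := (fun w => (W t w - W s w) j 0).

Let t0 : 0 <= t. Proof. exact: ltW (le_lt_trans s0 st). Qed.

Let sd_gt0 : 0 < Num.sqrt (t - s).
Proof. by rewrite sqrtr_gt0 subr_gt0. Qed.

Let sd_sqr : Num.sqrt (t - s) ^+ 2 = t - s.
Proof. by rewrite sqr_sqrtr// subr_ge0 ltW. Qed.

Lemma measurable_bm_increment : measurable_fun setT U.
Proof. by apply: mxmeasB; exact: bm_mxmeas. Qed.

Let mZ' : measurable_fun setT Z.
Proof. exact: (past_ambient filtF s0 mZ). Qed.

Let indepZU (A B : set R) : measurable A -> measurable B ->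
  P (Z @^-1` A `&` U @^-1` B) =
  (P (Z @^-1` A) * normal_prob 0 (Num.sqrt (t - s)) B)%E.
Proof.
move=> mA mB; apply: bm_increment_indep => //.
by move/(measurable_fun_past filtF _ s0) : mZ; exact.
Qed.

Lemma bm_increment_sqr_le : (forall w, 0 <= Z w) ->
  (\int[P]_w (Z w * U w ^+ 2)%:E <= (8 * (t - s))%:E * \int[P]_w (Z w)%:E)%E.
Proof.
move=> Z0; rewrite -sd_sqr.
exact: (indep_increment_sqr_le mZ' measurable_bm_increment).
Qed.

End Moments.

Lemma bm_increment_second_moment s t j : 0 <= s -> s < t ->
  (\int[P]_w ((W t w - W s w) j 0 ^+ 2)%:E <= (8 * (t - s))%:E)%E.
Proof.
move=> s0 st; have := @bm_increment_sqr_le s t j (cst 1) s0 st.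
under eq_integral do rewrite mul1r.
have -> : (\int[P]_w (cst 1 w : R)%:E = 1)%E.
  rewrite [LHS](integral_cst P measurableT 1%E) mul1e.
  exact: probability_setT.
by rewrite mule1; apply=> //; exact: measurable_cst.
Qed.

Lemma integrable_bm_increment_sqr s t j : 0 <= s -> s < t ->
  P.-integrable setT (fun w => ((W t w - W s w) j 0 ^+ 2)%:E).
Proof.
move=> s0 st; apply/integrableP; split.
  apply/measurable_EFinP/measurable_funX.
  exact: measurable_bm_increment.
under eq_integral do rewrite gee0_abs ?lee_fin ?sqr_ge0//.
exact: le_lt_trans (bm_increment_second_moment j s0 st) (ltry _).
Qed.

Lemma bm_increment_mean0 s t j (Z : Om -> R) (C : R) :
  0 <= s -> s < t -> measurable_fun setT (Z : past F s -> R) ->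
  (forall w, `|Z w| <= C) ->
  P.-integrable setT (fun w => (Z w * (W t w - W s w) j 0)%:E) /\
  (\int[P]_w (Z w * (W t w - W s w) j 0)%:E = 0)%E.
Proof.
move=> s0 st mZ ZC.
have mZ' : measurable_fun setT Z by exact: (past_ambient filtF s0 mZ).
have mU : measurable_fun setT (fun w => (W t w - W s w) j 0).
  exact: measurable_bm_increment.
have iZU : P.-integrable setT (fun w => (Z w * (W t w - W s w) j 0)%:E).
  apply: (integrable_bounded_sqr mZ' mU ZC).
  exact: integrable_bm_increment_sqr.
split=> //; apply: (indep_increment_mean0 (s := Num.sqrt (t - s))) => //.
  by rewrite sqrtr_gt0 subr_gt0.
move=> A B mA mB; apply: bm_increment_indep => //.
by move/(measurable_fun_past filtF _ s0) : mZ; exact.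
Qed.

End BrownianIncrements.

Section DiscreteMaximalInequality.
Context (R : realType) dO (Om : measurableType dO) (P : probability Om R).
Variable F : R -> set (set Om).
Variables (m : nat) (W : R -> Om -> 'cV[R]_m).
Hypothesis filtF : usual_filtration P F.
Hypothesis bmW : brownian_motion P F W.
Variables (d n : nat) (v : nat -> R) (Y : nat -> Om -> 'M[R]_(d, m)).
Variables (a c C : R).
Hypotheses (v0 : 0 <= v 0%N) (v_le : forall k, (k < n)%N -> v k <= v k.+1).
Hypothesis mY : forall k, (k < n)%N ->
  mxmeas (Y k : past F (v k) -> 'M[R]_(d, m)).
Hypothesis Y_bounded : forall k w, (k < n)%N -> enorm (Y k w) <= C.
Hypotheses (a_gt0 : 0 < a) (c_ge0 : 0 <= c).

Local Notation dW k w := (W (v k.+1) w - W (v k) w).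
Local Notation dA k w := (enorm (Y k w) ^+ 2 * (v k.+1 - v k)).

Definition disc_int (k : nat) (w : Om) : 'cV[R]_d :=
  \sum_(j < k) Y j w *m dW j w.

Definition disc_bracket (k : nat) (w : Om) : R := \sum_(j < k) dA j w.

(** The integral and its bracket, with every increment dropped that would push
    the bracket above c or that comes after the integral has left the open ball
    of radius a.  The decision to drop an increment is taken before it is
    revealed, so the martingale property survives. *)
Fixpoint gated (k : nat) (w : Om) : 'cV[R]_d * R :=
  if k is k'.+1 then
    let: (N, B) := gated k' w in
    let gate := if (B + dA k' w <= c) && (enorm N < a) then 1 else 0 in
    (N + gate *: (Y k' w *m dW k' w), B + gate * dA k' w)
  else (0, 0).

Local Notation N k w := (gated k w).1.
Local Notation B k w := (gated k w).2.
Let gate k w : R :=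
  if (B k w + dA k w <= c) && (enorm (N k w) < a) then 1 else 0.

Let gatedS k w :
  gated k.+1 w = (N k w + gate k w *: (Y k w *m dW k w),
                  B k w + gate k w * dA k w).
Proof. by rewrite /gate /=; case: (gated k w). Qed.

Let gate_ge0 k w : 0 <= gate k w.
Proof. by rewrite /gate; case: ifP. Qed.

Let gate_idem k w : gate k w * gate k w = gate k w.
Proof. by rewrite /gate; case: ifP; rewrite ?mulr1 ?mulr0. Qed.

Let dA_ge0 k w : (k < n)%N -> 0 <= dA k w.
Proof. by move=> kn; rewrite mulr_ge0 ?sqr_ge0 ?subr_ge0 ?v_le. Qed.

Let v_ge0 k : (k <= n)%N -> 0 <= v k.
Proof.
elim: k => // k IH kn; apply: le_trans (v_le kn); exact/IH/ltnW.
Qed.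

Let B_bounds k w : (k <= n)%N -> 0 <= B k w <= c.
Proof.
elim: k => [|k IH] kn; first by rewrite lexx.
have /andP[B0 Bc] := IH (ltnW kn).
rewrite gatedS/= /gate; case: ifPn => [/andP[le_c _]|_].
  by rewrite mul1r le_c andbT addr_ge0// dA_ge0.
by rewrite mul0r addr0 B0.
Qed.

Let measurable_dA k : (k < n)%N ->
  measurable_fun setT ((fun w => dA k w) : past F (v k) -> R).
Proof.
move=> kn; apply: measurable_funM; last exact: measurable_cst.
by apply: (@measurable_enorm_sqr _ (past F (v k))); exact: mY.
Qed.

Let measurable_gate k : (k < n)%N ->
  mxmeas ((fun w => N k w) : past F (v k) -> 'cV[R]_d) ->
  measurable_fun setT ((fun w => B k w) : past F (v k) -> R) ->
  measurable_fun setT (gate k : past F (v k) -> R).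
Proof.
move=> kn mN mB; apply: measurable_fun_ifT; [|exact: measurable_cst..].
apply: measurable_and.
  apply: measurable_fun_ler; last exact: measurable_cst.
  by apply: measurable_funD => //; exact: measurable_dA.
by apply: measurable_fun_ltr; [exact: measurable_enorm|exact: measurable_cst].
Qed.

Let gated_adapted k : (k <= n)%N ->
  mxmeas ((fun w => N k w) : past F (v k) -> 'cV[R]_d) /\
  measurable_fun setT ((fun w => B k w) : past F (v k) -> R).
Proof.
elim: k => [_|k IH kn].
  by split; [exact: mxmeas_cst|exact: measurable_cst].
have [mN mB] := IH (ltnW kn).
have mg := measurable_gate kn mN mB.
have vk0 := v_ge0 (ltnW kn); have vk := v_le kn.
have up (Z : Om -> R) : measurable_fun setT (Z : past F (v k) -> R) ->
    measurable_fun setT (Z : past F (v k.+1) -> R).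
  exact: (past_mono filtF vk0 vk).
split; under eq_fun do rewrite gatedS/=.
  apply: mxmeasD; first exact: (mxmeas_past_mono filtF vk0 vk).
  apply: mxmeasZ; first exact: up.
  apply: mxmeasM.
    exact: (mxmeas_past_mono filtF vk0 vk (mY kn)).
  apply: mxmeasB; apply: (bm_mxmeas_past filtF bmW) => //.
  exact: le_trans vk.
apply: measurable_funD; first exact: up.
by apply: measurable_funM; [exact: up|exact: (up _ (measurable_dA kn))].
Qed.

Let mN k : (k <= n)%N -> measurable_fun setT (fun w => enorm (N k w) ^+ 2).
Proof.
move=> kn; apply: measurable_enorm_sqr.
by apply: (mxmeas_past_ambient filtF (v_ge0 kn)); have [] := gated_adapted kn.
Qed.

Let mB k : (k <= n)%N -> measurable_fun setT (fun w => B k w).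
Proof.
move=> kn; apply: (past_ambient filtF (v_ge0 kn)).
by have [] := gated_adapted kn.
Qed.

Let cross k (j : 'I_m) w : R :=
  2 * (gate k w * \sum_i N k w i 0 * Y k w i j).

(* |x + u| ^ 2 = |x| ^ 2 + 2 <x, u> + |u| ^ 2 with u the gated increment; the
   middle term is sorted by Brownian coordinates, because each coefficient
   cross k j is known at time v k. *)
Let gated_sqr_le k w :
  enorm (N k.+1 w) ^+ 2 <= enorm (N k w) ^+ 2
    + \sum_(j < m) cross k j w * dW k w j 0
    + \sum_(j < m) (gate k w * enorm (Y k w) ^+ 2) * dW k w j 0 ^+ 2.
Proof.
rewrite gatedS/= -!inner_enorm.
set x := N k w; set u := gate k w *: _.
have -> : inner (x + u) (x + u) = inner x x + 2 * inner x u + inner u u.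
  rewrite /inner mulr_sumr -!big_split/=; apply: eq_bigr => i _.
  by rewrite !mxE; ring.
rewrite lerD//.
  rewrite lerD2l /u innerZr /inner /cross.
  under [leRHS]eq_bigr do rewrite -mulrA -[_ * _ * dW k w _ 0]mulrA mulr_suml.
  rewrite -mulr_sumr -mulr_sumr exchange_big/= le_eqVlt; apply/orP; left.
  apply/eqP; congr (2 * (_ * _)); apply: eq_bigr => i _.
  by rewrite mxE mulr_sumr; apply: eq_bigr => j _; rewrite mulrA.
rewrite inner_enorm /u enormZ exprMn ger0_norm ?gate_ge0//.
rewrite -mulr_sumr -enorm_sqr_cV expr2 gate_idem -mulrA.
by rewrite ler_wpM2l// enorm_mulmx_sqr.
Qed.

(* An open gate means that the gated integral is still in the ball, which is
   what makes the coefficients of the middle term bounded. *)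
Let cross_bound k j w : (k < n)%N -> `|cross k j w| <= 2 * (d%:R * (a * C)).
Proof.
move=> kn; have C0 : 0 <= C.
  by apply: le_trans (Y_bounded w kn); exact: enorm_ge0.
rewrite /cross normrM ger0_norm// ler_wpM2l//.
rewrite /gate; case: ifPn => [/andP[_ Na]|_]; last first.
  by rewrite mul0r normr0 !mulr_ge0// ltW.
rewrite mul1r; apply: le_trans (ler_norm_sum _ _ _) _.
apply: (@le_trans _ _ (\sum_(i < d) a * C)).
  apply: ler_sum => i _; rewrite normrM ler_pM//.
    exact: le_trans (le_coord_enorm _ _ _) (ltW Na).
  exact: le_trans (le_coord_enorm _ _ _) (Y_bounded w kn).
by rewrite sumr_const card_ord mulr_natl.
Qed.

Let measurable_cross k j : (k < n)%N ->
  measurable_fun setT (cross k j : past F (v k) -> R).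
Proof.
move=> kn; have [mNk mBk] := gated_adapted (ltnW kn).
apply: measurable_funM; first exact: measurable_cst.
apply: measurable_funM; first exact: measurable_gate.
apply: measurable_sum => i; apply: measurable_funM; first exact: mNk.
exact: mY.
Qed.

(** The middle terms have mean zero, and the last one is bounded by the gated
    bracket, coordinate by coordinate. *)
Let gated_second_moment k : (k <= n)%N ->
  P.-integrable setT (fun w => (enorm (N k w) ^+ 2)%:E) /\
  (\int[P]_w (enorm (N k w) ^+ 2)%:E <= (8 * m%:R)%:E * \int[P]_w (B k w)%:E)%E.
Proof.
elim: k => [_|k IH kn].
  rewrite /= enorm0 expr0n/=.
  by rewrite !integral0 mule0; split => //; exact: integrable0.
have [iN leN] := IH (ltnW kn).
have iB l : (l <= n)%N -> P.-integrable setT (fun w => (B l w)%:E).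
  move=> ln; apply: measurable_bounded_integrable => //.
  - by apply: (@le_lt_trans _ _ 1%E); [exact: probability_le1|exact: ltry].
  - exact: mB.
  - exists c; split; first exact: num_real.
    move=> x cx w _; have /andP[B0 Bc] := B_bounds w ln.
    by rewrite /= ger0_norm//; exact: le_trans (ltW cx).
have vk0 := v_ge0 (ltnW kn).
(* a degenerate time step contributes nothing; the moment formulas for
   increments need a positive one *)
have := v_le kn; rewrite le_eqVlt => /orP[/eqP vE|vlt].
  have E w : gated k.+1 w = gated k w.
    rewrite gatedS -vE !subrr mulmx0 scaler0 !mulr0 !addr0.
    by case: (gated k w).
  under eq_fun do rewrite E.
  by under [X in (_ <= _ * X)%E]eq_integral do rewrite E.
have [mNk mBk] := gated_adapted (ltnW kn).
pose z w := gate k w * enorm (Y k w) ^+ 2.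
have z0 w : 0 <= z w by rewrite mulr_ge0 ?sqr_ge0.
have mz : measurable_fun setT (z : past F (v k) -> R).
  apply: measurable_funM; first exact: measurable_gate.
  by apply: (@measurable_enorm_sqr _ (past F (v k))); exact: mY.
have mz' : measurable_fun setT z by exact: (past_ambient filtF vk0 mz).
pose X1 w := \sum_(j < m) cross k j w * dW k w j 0.
pose X2 w := \sum_(j < m) z w * dW k w j 0 ^+ 2.
have iX1 : P.-integrable setT (fun w => (X1 w)%:E) /\
    (\int[P]_w (X1 w)%:E = 0)%E.
  have H j := bm_increment_mean0 filtF bmW j vk0 vlt
    (measurable_cross j kn) (fun w => cross_bound j w kn).
  have E w : (X1 w)%:E = (\sum_(j < m) (cross k j w * dW k w j 0)%:E)%E.
    by rewrite sumEFin.
  under eq_fun do rewrite E.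
  split; first by apply: integrable_sum => // j _; have [] := H j.
  rewrite integral_sum//; last by move=> j; have [] := H j.
  by rewrite big1// => j _; have [] := H j.
have zB w : (z w * (v k.+1 - v k)) = B k.+1 w - B k w.
  by rewrite gatedS/= addrAC subrr add0r /z mulrA.
have mdW j : measurable_fun setT (fun w => dW k w j 0).
  by apply: (measurable_bm_increment filtF bmW).
have iX2 : (\int[P]_w (X2 w)%:E <=
    (8 * m%:R)%:E * (\int[P]_w (B k.+1 w)%:E - \int[P]_w (B k w)%:E))%E.
  have E w : (X2 w)%:E = (\sum_(j < m) (z w * dW k w j 0 ^+ 2)%:E)%E.
    by rewrite sumEFin.
  under eq_integral do rewrite E.
  rewrite ge0_integral_sum//; last 2 first.
  - move=> j; apply/measurable_EFinP; apply: measurable_funM => //.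
    by apply: measurable_funX.
  - by move=> j w _; rewrite lee_fin mulr_ge0// sqr_ge0.
  rewrite -integralB_EFin//; [|exact: iB|exact/iB/ltnW].
  under [X in (_ <= _ * X)%E]eq_integral do rewrite -EFinB -zB mulrC EFinM.
  rewrite ge0_integralZl_EFin//; last 3 first.
  - by move=> w _; rewrite lee_fin.
  - exact/measurable_EFinP.
  - by rewrite subr_ge0 ltW.
  apply: (@le_trans _ _ (\sum_(j < m)
      (8 * (v k.+1 - v k))%:E * \int[P]_w (z w)%:E))%E.
    apply: lee_sum => j _.
    exact: (bm_increment_sqr_le filtF bmW).
  rewrite -ge0_sume_distrl; last first.
    by move=> j _; rewrite lee_fin mulr_ge0// subr_ge0 ltW.
  rewrite sumEFin sumr_const card_ord muleA -EFinM.
  apply: lee_wpmul2r; first by apply: integral_ge0 => w _; rewrite lee_fin.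
  by rewrite lee_fin le_eqVlt; apply/orP; left; apply/eqP; ring.
have X20 w : 0 <= X2 w.
  by apply: sumr_ge0 => j _; rewrite mulr_ge0// sqr_ge0.
have iX2' : P.-integrable setT (fun w => (X2 w)%:E).
  apply/integrableP; split.
    apply/measurable_EFinP; apply: measurable_sum => j.
    by apply: measurable_funM => //; exact: measurable_funX.
  under eq_integral do rewrite gee0_abs ?lee_fin//.
  apply: le_lt_trans iX2 _.
  have := integrable_fin_num measurableT (iB _ kn).
  have := integrable_fin_num measurableT (iB _ (ltnW kn)).
  move=> f1 f2; rewrite ltey_eq; apply/orP; left.
  by rewrite fin_numM// fin_numB f1 f2.
have le_pt w : ((enorm (N k.+1 w) ^+ 2)%:E <=
    (enorm (N k w) ^+ 2)%:E + (X1 w)%:E + (X2 w)%:E)%E.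
  by rewrite -!EFinD lee_fin; exact: gated_sqr_le.
have iS : P.-integrable setT
    (fun w => ((enorm (N k w) ^+ 2)%:E + (X1 w)%:E + (X2 w)%:E)%E).
  by apply: integrableD => //; apply: integrableD => //; have [] := iX1.
have iN' : P.-integrable setT (fun w => (enorm (N k.+1 w) ^+ 2)%:E).
  apply: le_integrable iS => //.
    by apply/measurable_EFinP; exact: mN.
  move=> w _; rewrite gee0_abs ?lee_fin ?sqr_ge0//.
  exact: le_trans (le_pt w) (lee_abs _).
split => //.
apply: (@le_trans _ _ (\int[P]_w ((enorm (N k w) ^+ 2)%:E + (X1 w)%:E +
    (X2 w)%:E))%E).
  by apply: le_integral => // w _; exact: le_pt.
rewrite integralD//; last by apply: integrableD => //; have [] := iX1.
rewrite integralD//; last by have [] := iX1.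
rewrite (proj2 iX1) adde0.
apply: le_trans (leeD leN iX2) _.
rewrite -muleDr//; last first.
  rewrite fin_num_adde_defr//.
  exact: integrable_fin_num (iB _ (ltnW kn)).
rewrite [X in (_ * X <= _)%E]addeC subeK//.
exact: integrable_fin_num (iB _ (ltnW kn)).
Qed.

(** As long as neither threshold has been crossed the gated pair is the true
    one, and once the gated integral has left the ball it never moves again. *)
Let gated_exit k w : (k <= n)%N -> disc_bracket k w <= c ->
  a <= enorm (disc_int k w) -> a <= enorm (N n w).
Proof.
elim/ltn_ind: k => k IH kn Ac Ma.
have [[j jk]|no] := pselect (exists2 j, (j < k)%N & a <= enorm (disc_int j w)).
  apply: (IH j) => //; first exact: leq_trans (ltnW jk) kn.
  apply: le_trans Ac; rewrite /disc_bracket -(subnKC (ltnW jk)) big_split_ord/=.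
  rewrite lerDl sumr_ge0// => i _; apply: dA_ge0; apply: leq_trans kn.
  by rewrite -ltn_subRL.
have NM j : (j <= k)%N -> gated j w = (disc_int j w, disc_bracket j w).
  elim: j => [_|j IHj jk]; first by rewrite /disc_int /disc_bracket !big_ord0.
  rewrite gatedS (IHj (ltnW jk))/= /gate (IHj (ltnW jk))/=.
  have -> : disc_bracket j w + dA j w <= c.
    apply: le_trans Ac; rewrite /disc_bracket.
    have -> : \sum_(j0 < j) dA j0 w + dA j w = \sum_(j0 < j.+1) dA j0 w.
      by rewrite big_ord_recr.
    rewrite -(subnKC jk) big_split_ord/= lerDl sumr_ge0// => i _.
    by apply: dA_ge0; apply: leq_trans kn; rewrite -ltn_subRL.
  have -> : enorm (disc_int j w) < a.
    by rewrite ltNge; apply/negP => aj; apply: no; exists j.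
  by rewrite scale1r mul1r /disc_int /disc_bracket !big_ord_recr.
have stay l : (k + l <= n)%N -> N (k + l)%N w = disc_int k w.
  elim: l => [_|l IHl kl]; first by rewrite addn0 NM.
  move: kl; rewrite addnS => kl; have E := IHl (ltnW kl).
  rewrite gatedS/= /gate E ltNge Ma andbF scale0r addr0//.
by rewrite -(subnKC kn) stay// subnKC.
Qed.

(** On the event in question the gate has stayed open up to the exit from the
    ball, so the gated integral has left the ball too; its second moment is at
    most 8 m c, and Markov's inequality concludes. *)
Lemma disc_maximal_inequality : exists E : set Om,
  [/\ measurable E, (P E <= (8 * m%:R * c / a ^+ 2)%:E)%E &
   forall k w, (k <= n)%N -> disc_bracket k w <= c ->
     a <= enorm (disc_int k w) -> E w].
Proof.
have [iN leN] := gated_second_moment (leqnn n).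
have a20 : 0 < a ^+ 2 by rewrite exprn_gt0.
exists (setT `&` [set w | ((a ^+ 2)%:E <= `|(enorm (N n w) ^+ 2)%:E|)%E]).
have mN2 : measurable_fun setT (fun w => (enorm (N n w) ^+ 2)%:E).
  by apply/measurable_EFinP; exact: mN.
split.
- by apply: emeasurable_fun_c_infty => //; exact: measurableT_comp.
- have := @le_integral_comp_abse _ _ _ P setT measurableT
    (fun w => (enorm (N n w) ^+ 2)%:E) (a ^+ 2) id (@measurable_id _ _ _)
    (fun r r0 => r0) (fun x y _ _ xy => xy) mN2 a20.
  under [X in (_ <= X)%E -> _]eq_integral do rewrite gee0_abs ?lee_fin ?sqr_ge0//.
  move=> /le_trans /(_ leN) H.
  have : (\int[P]_w (B n w)%:E <= c%:E)%E.
    apply: (@le_trans _ _ (\int[P]_w (cst c%:E w))%E).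
      apply: ge0_le_integral => //.
      + by move=> w _; rewrite lee_fin; have /andP[] := B_bounds w (leqnn n).
      + by apply/measurable_EFinP; exact: mB.
      + by move=> w _; rewrite lee_fin; have /andP[] := B_bounds w (leqnn n).
    by rewrite integral_cst// [X in (_ * X)%E]probability_setT mule1.
  move=> Bc; rewrite [X in (_ <= X)%E]EFinM lee_pdivlMr// muleC.
  apply: le_trans H _.
  by rewrite [X in (_ <= X)%E]EFinM; apply: lee_wpmul2l => //; rewrite lee_fin.
- move=> k w kn Ac Ma; split => //=.
  rewrite lee_fin ger0_norm ?sqr_ge0// ler_sqr ?nnegrE ?enorm_ge0 ?(ltW a_gt0)//.
  exact: (gated_exit kn Ac Ma).
Qed.

End DiscreteMaximalInequality.

(** * Continuity of paths in the Euclidean norm *)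

Section PathContinuity.
Variable R : realType.

Lemma nbhs_enorm p n (M : 'M[R]_(p, n)) e : 0 < e ->
  nbhs M [set N | enorm (N - M) < e].
Proof.
move=> e0; pose e' := e / (p * n).+1%:R.
have e'0 : 0 < e' by rewrite divr_gt0.
apply: filterS (nbhsx_ballx M e' e'0) => N /= MN.
apply: (@le_lt_trans _ _ ((p * n)%:R * e')).
  apply: enorm_mx_norm => [|i j]; first exact: ltW.
  by rewrite !mxE distrC ltW//; have [_ /(_ i j)] := MN.
by rewrite /e' mulrCA gtr_pMr// ltr_pdivrMr// mul1r ltr_nat.
Qed.

Lemma within_continuous_enorm (A : set R) p n (y : R -> 'M[R]_(p, n)) t e :
  {within A, continuous y} -> A t -> 0 < e ->
  exists2 dl, 0 < dl & forall u, A u -> `|u - t| < dl -> enorm (y u - y t) < e.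
Proof.
move=> /subspace_continuousP /(_ t) + At e0 => /(_ At) cy.
have := cy _ (nbhs_enorm (y t) e0); rewrite /within/= => -[dl dl0 H].
by exists dl => // u Au ut; apply: H => //=; rewrite distrC.
Qed.
(** Continuity relative to the interval, written out with epsilon and delta so
    that paths can be added and reparametrized without transporting subspace
    topologies. *)
Definition mx_path_continuous (a b : R) p n (y : R -> 'M[R]_(p, n)) : Prop :=
  forall t e, a <= t <= b -> 0 < e -> exists2 dl, 0 < dl &
    forall u, a <= u <= b -> `|u - t| < dl -> enorm (y u - y t) < e.

Lemma within_mx_path_continuous (A : set R) a b p n (y : R -> 'M[R]_(p, n)) :
  {within A, continuous y} -> (forall t, a <= t <= b -> A t) ->
  mx_path_continuous a b y.
Proof.
move=> cy abA t e tab e0.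
have [dl dl0 H] := within_continuous_enorm cy (abA t tab) e0.
by exists dl => // u uab; apply/H/abA.
Qed.

Lemma mx_path_continuous_cst a b p n (M : 'M[R]_(p, n)) :
  mx_path_continuous a b (fun=> M).
Proof.
by move=> t e _ e0; exists 1 => // u _ _; rewrite subrr enorm0.
Qed.

Lemma mx_path_continuousD a b p n (y z : R -> 'M[R]_(p, n)) :
  mx_path_continuous a b y -> mx_path_continuous a b z ->
  mx_path_continuous a b (fun t => y t + z t).
Proof.
move=> cy cz t e tab e0; have e20 : 0 < e / 2 by rewrite divr_gt0.
have [d1 d10 H1] := cy t _ tab e20; have [d2 d20 H2] := cz t _ tab e20.
exists (Num.min d1 d2) => [|u uab]; first by rewrite lt_min d10.
rewrite lt_min => /andP[ud1 ud2].
rewrite opprD addrACA (splitr e); apply: le_lt_trans (enormD _ _) _.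
by rewrite ltrD ?H1 ?H2.
Qed.

Lemma mx_path_continuousM a b p k (M : 'M[R]_(k, p)) (y : R -> 'cV[R]_p) :
  mx_path_continuous a b y -> mx_path_continuous a b (fun t => M *m y t).
Proof.
move=> cy t e tab e0; pose K := enorm M + 1.
have K0 : 0 < K by rewrite ltr_wpDl ?enorm_ge0.
have [dl dl0 H] := cy t _ tab (divr_gt0 e0 K0).
exists dl => // u uab ut; rewrite -mulmxBr.
apply: le_lt_trans (enorm_mulmx _ _) _.
apply: (@le_lt_trans _ _ (K * enorm (y u - y t))).
  by rewrite ler_wpM2r ?enorm_ge0// lerDl.
by rewrite mulrC -ltr_pdivlMr//; exact: H.
Qed.

Lemma mx_path_continuousN a b p n (y : R -> 'M[R]_(p, n)) :
  mx_path_continuous a b y -> mx_path_continuous a b (fun t => - y t).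
Proof.
move=> cy t e tab e0; have [dl dl0 H] := cy t e tab e0.
by exists dl => // u uab ut; rewrite -opprD enormN; exact: H.
Qed.

Lemma mx_path_continuousB a b p n (y z : R -> 'M[R]_(p, n)) :
  mx_path_continuous a b y -> mx_path_continuous a b z ->
  mx_path_continuous a b (fun t => y t - z t).
Proof. by move=> cy cz; apply/mx_path_continuousD/mx_path_continuousN. Qed.

Lemma mx_path_continuous_sum a b p n k (y : 'I_k -> R -> 'M[R]_(p, n)) :
  (forall i, mx_path_continuous a b (y i)) ->
  mx_path_continuous a b (fun t => \sum_(i < k) y i t).
Proof.
elim: k y => [|k IH] y cy.
  under eq_fun do rewrite big_ord0; exact: mx_path_continuous_cst.
under eq_fun do rewrite big_ord_recr; apply: mx_path_continuousD => //.
exact: IH.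
Qed.

Lemma mx_path_continuous_min a b p n s (y : R -> 'M[R]_(p, n)) : a <= s ->
  mx_path_continuous a b y ->
  mx_path_continuous a b (fun t => y (Num.min s t)).
Proof.
move=> as_ cy t e /andP[at_ tb] e0.
have tin u : a <= u <= b -> a <= Num.min s u <= b.
  by move=> /andP[au ub]; rewrite le_min as_ au ge_min ub orbT.
have [|dl dl0 H] := cy (Num.min s t) e _ e0; first by rewrite tin// at_.
exists dl => // u uab ut; apply: H; first exact: tin.
apply: le_lt_trans ut; rewrite /Num.min.
by case: ltP => su; case: ltP => st; rewrite ?subrr ?normr0// !ler_norml;
  have := ler_norm (u - t); have := ler_norm (t - u); rewrite (distrC t);
  move=> h1 h2; apply/andP; split; lra.
Qed.

End PathContinuity.

(** * The maximal inequality for simple processes in continuous time *)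

Section SimpleProcess.
Context (R : realType) dO (Om : measurableType dO) (P : probability Om R).
Variable F : R -> set (set Om).
Variables (m d : nat) (W : R -> Om -> 'cV[R]_m).
Variable S : simple_process F d m.

Local Notation n := (sp_size S).
Local Notation s := (sp_time S).
Local Notation coef := (sp_coef S).

Lemma sp_time_mono i j : (i <= j)%N -> (j <= n)%N -> s i <= s j.
Proof.
elim: j => [|j IH]; first by rewrite leqn0 => /eqP->.
rewrite leq_eqVlt => /orP[/eqP->//|ij] jn.
by apply: le_trans (sp_time_le jn); apply: IH => //; exact: ltnW.
Qed.

Lemma sp_time_ge0 i : (i <= n)%N -> 0 <= s i.
Proof. by move=> ijn; apply: le_trans (sp_time0 S) _; exact: sp_time_mono. Qed.

(** The quadratic variation of the integral of a simple process, in the closed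
    form that mirrors sp_integral. *)
Definition sp_bracket (t : R) (w : Om) : R :=
  \sum_(i < n) enorm (coef i w) ^+ 2
    * (Num.min (s i.+1) t - Num.min (s i) t).

(* During a time interval on which the i-th value of the process is in force,
   the truncated j-th interval either does not change or stays empty. *)
Let min_diff_out (j : nat) (i : nat) (u t : R) : (i < n)%N -> (j < n)%N ->
  j != i -> s i <= u -> u <= t -> t <= s i.+1 ->
  (Num.min (s j.+1) t = Num.min (s j.+1) u /\ Num.min (s j) t = Num.min (s j) u)
  \/ (Num.min (s j.+1) t = Num.min (s j) t /\
      Num.min (s j.+1) u = Num.min (s j) u).
Proof.
move=> i_n jn; rewrite neq_ltn => /orP[ji|ij] iu ut ti; [left|right].
  have h : s j.+1 <= u by apply: le_trans iu; apply: sp_time_mono => //; exact: ltnW.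
  have h' : s j <= u by apply: le_trans h; exact: sp_time_le.
  rewrite !(min_idPl _)//; exact: le_trans ut.
have h : t <= s j by apply: le_trans ti _; apply: sp_time_mono => //; exact: ltnW.
have h' : t <= s j.+1 by apply: le_trans h _; exact: sp_time_le.
by rewrite !(min_idPr _)//; exact: le_trans ut _.
Qed.

Lemma sp_integral_increment i u t w : (i < n)%N ->
  s i <= u -> u <= t -> t <= s i.+1 ->
  sp_integral W S t w = sp_integral W S u w + coef i w *m (W t w - W u w).
Proof.
move=> i_n iu ut ti; rewrite /sp_integral.
rewrite (bigD1 (Ordinal i_n))//= [X in _ = X + _](bigD1 (Ordinal i_n))//=.
rewrite addrAC; congr (_ + _).
  rewrite -mulmxDr (min_idPr ti) (min_idPl (le_trans iu ut)).
  rewrite (min_idPr (le_trans ut ti)) (min_idPl iu).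
  by rewrite [X in _ = _ *m X]addrC addrA subrK.
apply: eq_bigr => j ji.
have [[-> ->]//|[-> ->]] := min_diff_out i_n (ltn_ord j) ji iu ut ti.
by rewrite !subrr.
Qed.

Lemma sp_bracket_increment i u t w : (i < n)%N ->
  s i <= u -> u <= t -> t <= s i.+1 ->
  sp_bracket t w = sp_bracket u w + enorm (coef i w) ^+ 2 * (t - u).
Proof.
move=> i_n iu ut ti; rewrite /sp_bracket.
rewrite (bigD1 (Ordinal i_n))//= [X in _ = X + _](bigD1 (Ordinal i_n))//=.
rewrite addrAC; congr (_ + _).
  rewrite -mulrDr (min_idPr ti) (min_idPl (le_trans iu ut)).
  rewrite (min_idPr (le_trans ut ti)) (min_idPl iu).
  by rewrite [X in _ = _ * X]addrC addrA subrK.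
apply: eq_bigr => j ji.
have [[-> ->]//|[-> ->]] := min_diff_out i_n (ltn_ord j) ji iu ut ti.
by rewrite !subrr.
Qed.

Lemma sp_integral_before t w : t <= s 0%N -> sp_integral W S t w = 0.
Proof.
move=> t0; rewrite /sp_integral big1// => i _.
have h : t <= s i by apply: le_trans t0 _; apply: sp_time_mono => //; exact: ltnW.
rewrite (min_idPr h) (min_idPr _) ?subrr ?mulmx0//.
by apply: le_trans h _; exact: sp_time_le.
Qed.

Lemma sp_bracket_before t w : t <= s 0%N -> sp_bracket t w = 0.
Proof.
move=> t0; rewrite /sp_bracket big1// => i _.
have h : t <= s i by apply: le_trans t0 _; apply: sp_time_mono => //; exact: ltnW.
rewrite (min_idPr h) (min_idPr _) ?subrr ?mulr0//.
by apply: le_trans h _; exact: sp_time_le.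
Qed.

Let min_after i t : (i <= n)%N ->
  Num.min (s i) (Num.min t (s n)) = Num.min (s i) t.
Proof.
move=> i_n; rewrite minCA minC; have h := sp_time_mono i_n (leqnn n).
by rewrite (min_idPl h).
Qed.

Lemma sp_integral_after t w :
  sp_integral W S (Num.min t (s n)) w = sp_integral W S t w.
Proof.
by apply: eq_bigr => i _; rewrite !min_after//; exact: ltnW.
Qed.

Lemma sp_bracket_after t w : sp_bracket (Num.min t (s n)) w = sp_bracket t w.
Proof.
by apply: eq_bigr => i _; rewrite !min_after//; exact: ltnW.
Qed.

Lemma sp_bracket_mono i u t w : (i < n)%N ->
  s i <= u -> u <= t -> t <= s i.+1 -> sp_bracket u w <= sp_bracket t w.
Proof.
move=> i_n iu ut ti; rewrite (sp_bracket_increment w i_n iu ut ti) lerDl.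
by rewrite mulr_ge0 ?sqr_ge0 ?subr_ge0.
Qed.

Lemma sp_time_locate t : s 0%N < t -> t <= s n ->
  exists2 i, (i < n)%N & s i < t <= s i.+1.
Proof.
move=> t0; move: (n) => k; elim: k => [|k IH]; first by rewrite leNgt t0.
have [tk _|kt tk] := leP t (s k); last by exists k => //; rewrite kt.
by have [i ik it] := IH tk; exists i => //; exact: ltnW.
Qed.

Section Grid.
Variable N : nat.
Hypothesis N_gt0 : (0 < N)%N.

(** Each interval between consecutive times of the process is cut into N equal
    parts. *)
Definition sp_grid (k : nat) : R :=
  s (k %/ N) + (k %% N)%:R / N%:R * (s (k %/ N).+1 - s (k %/ N)).

Let sp_grid_succ k :
  sp_grid k.+1 =
  s (k %/ N) + (k %% N).+1%:R / N%:R * (s (k %/ N).+1 - s (k %/ N)).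
Proof.
rewrite /sp_grid; have kE := divn_eq k N.
have : ((k %% N).+1 <= N)%N by rewrite ltn_mod.
rewrite leq_eqVlt => /orP[/eqP kN|kN].
  have E : k.+1 = ((k %/ N).+1 * N)%N by rewrite {1}kE -addnS kN mulSn addnC.
  rewrite {1 2 3 4}E mulnK// modnMl mul0r mul0r addr0 kN divff ?mul1r.
    by rewrite addrC subrK.
  by rewrite pnatr_eq0 -lt0n.
have E : k.+1 = ((k %/ N) * N + (k %% N).+1)%N by rewrite addnS -kE.
rewrite {1 2 3 4}E divnMDl// (divn_small kN) addn0 modnMDl modn_small//.
Qed.

Let frac_bounds k : 0 <= (k %% N)%:R / N%:R :> R /\
  (k %% N).+1%:R / N%:R <= 1 :> R.
Proof.
split; first by rewrite divr_ge0.
by rewrite ler_pdivrMr ?ltr0n// mul1r ler_nat ltn_mod.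
Qed.

Lemma sp_grid_bounds k : (k < n * N)%N ->
  [/\ s (k %/ N) <= sp_grid k, sp_grid k <= sp_grid k.+1 &
      sp_grid k.+1 <= s (k %/ N).+1].
Proof.
move=> kn; have i_n : (k %/ N < n)%N by rewrite ltn_divLR.
have h : 0 <= s (k %/ N).+1 - s (k %/ N) by rewrite subr_ge0 sp_time_le.
have [f0 f1] := frac_bounds k.
rewrite sp_grid_succ /sp_grid; split.
- by rewrite lerDl mulr_ge0.
- rewrite lerD2l ler_wpM2r// ler_wpM2r ?invr_ge0// ler_nat.
  exact: leqnSn.
- by rewrite -lerBrDl -[leRHS]mul1r ler_wpM2r.
Qed.

Lemma sp_grid0 : sp_grid 0 = s 0%N.
Proof. by rewrite /sp_grid div0n mod0n !mul0r addr0. Qed.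

Lemma disc_int_grid k w : (k <= n * N)%N ->
  disc_int W sp_grid (fun k => coef (k %/ N)) k w =
    sp_integral W S (sp_grid k) w /\
  disc_bracket sp_grid (fun k => coef (k %/ N)) k w =
    sp_bracket (sp_grid k) w.
Proof.
elim: k => [_|k IH kn].
  rewrite /disc_int /disc_bracket !big_ord0 sp_grid0.
  by rewrite sp_integral_before// sp_bracket_before.
have [IHi IHb] := IH (ltnW kn); have [h1 h2 h3] := sp_grid_bounds kn.
have i_n : (k %/ N < n)%N by rewrite ltn_divLR.
rewrite (sp_integral_increment w i_n h1 h2 h3).
rewrite (sp_bracket_increment w i_n h1 h2 h3) -IHi -IHb.
by rewrite /disc_int /disc_bracket !big_ord_recr.
Qed.

(** The approximation is from the left, where the nondecreasing bracket is no
    larger than at t. *)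
Lemma sp_grid_approx i t : (i < n)%N -> s i < t -> t <= s i.+1 ->
  exists k, [/\ (k <= n * N)%N, s i <= sp_grid k, sp_grid k <= t &
    t - sp_grid k <= (s i.+1 - s i) / N%:R].
Proof.
move=> i_n it ti; have N0 : 0 < N%:R :> R by rewrite ltr0n.
pose D := s i.+1 - s i.
have D0 : 0 < D by rewrite subr_gt0 (lt_le_trans it).
pose x := (t - s i) / D * N%:R.
have x0 : 0 <= x by rewrite mulr_ge0// divr_ge0 ?ltW// subr_gt0.
pose l := Num.truncn x.
have /andP[lx xl] : l%:R <= x < l.+1%:R by exact: truncn_itv.
have tE : t = s i + x / N%:R * D.
  by rewrite /x; field; rewrite !gt_eqF.
have xN : x <= N%:R.
  by rewrite /x ler_piMl ?(ltW N0)// ler_pdivrMr// mul1r lerD2r.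
have gE : sp_grid (i * N + l) = s i + l%:R / N%:R * D.
  have : (l <= N)%N by rewrite -(ler_nat R) (le_trans lx).
  rewrite leq_eqVlt => /orP[/eqP lN|lN].
    rewrite /sp_grid lN -mulSnr mulnK// modnMl !mul0r addr0 divff ?gt_eqF//.
    by rewrite mul1r /D addrC subrK.
  by rewrite /sp_grid divnMDl// divn_small// addn0 modnMDl modn_small.
exists (i * N + l)%N; rewrite gE; split.
- rewrite (@leq_trans (i.+1 * N))// ?leq_mul2r ?i_n ?orbT//.
  by rewrite mulSnr leq_add2l -(ler_nat R) (le_trans lx).
- by rewrite lerDl mulr_ge0// ?divr_ge0// (ltW D0).
- by rewrite tE lerD2l ler_wpM2r ?(ltW D0)// ler_wpM2r// invr_ge0 ltW.
- rewrite {1}tE opprD addrACA subrr add0r -mulrBl -mulrBl.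
  rewrite mulrAC ler_wpM2r ?invr_ge0 ?(ltW N0)//.
  rewrite -/D -[leRHS]mul1r ler_wpM2r ?(ltW D0)//.
  by rewrite lerBlDr addrC natr1 ltW.
Qed.

End Grid.

Hypothesis filtF : usual_filtration P F.
Hypothesis bmW : brownian_motion P F W.

(** Along a grid of mesh going to 0 the discrete inequality holds with the same
    bound; a path that exceeds a strictly at some time does so at a grid point
    of every sufficiently fine grid, so the event is contained in the lower
    limit of the grid events. *)
Lemma sp_maximal_inequality (a c : R) : 0 < a -> 0 <= c ->
  exists E : set Om,
  [/\ measurable E, (P E <= (8 * m%:R * c / a ^+ 2)%:E)%E &
   forall w, {within `[0, +oo[, continuous (W ^~ w)} ->
   forall t, sp_bracket t w <= c -> a < enorm (sp_integral W S t w) -> E w].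
Proof.
move=> a0 c0.
have [C YC] := sp_coef_bounded S.
have H N : {E : set Om | [/\ measurable E,
     (P E <= (8 * m%:R * c / a ^+ 2)%:E)%E &
     forall k w, (k <= n * N.+1)%N ->
       sp_bracket (sp_grid N.+1 k) w <= c ->
       a <= enorm (sp_integral W S (sp_grid N.+1 k) w) -> E w]}.
  apply: cid.
  have [] := @disc_maximal_inequality R dO Om P F m W filtF bmW d
    (n * N.+1) (sp_grid N.+1) (fun k => coef (k %/ N.+1)) a c C => //.
  - by rewrite sp_grid0 sp_time0.
  - by move=> k kn; have [] := sp_grid_bounds (ltn0Sn N) kn.
  - move=> k kn; have [h _ _] := sp_grid_bounds (ltn0Sn N) kn.
    have i_n : (k %/ N.+1 < n)%N by rewrite ltn_divLR.
    have s0 := sp_time_ge0 (ltnW i_n).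
    apply: (mxmeas_past_mono filtF s0 h).
    by apply: (mxmeas_past filtF s0); exact: sp_coef_meas.
  - by move=> k w kn; apply: YC; rewrite ltn_divLR.
  - move=> E [mE PE HE]; exists E; split=> // k w kn Ac Ma.
    have [i_ b_] := disc_int_grid (ltn0Sn N) w kn.
    by apply: (HE k) => //; rewrite ?i_ ?b_.
pose G N := \bigcap_(q in [set q | (N <= q)%N]) sval (H q).
have mE q : measurable (sval (H q)) by case: (H q) => E [].
have PE q : (P (sval (H q)) <= (8 * m%:R * c / a ^+ 2)%:E)%E.
  by case: (H q) => E [].
have mG N : measurable (G N) by apply: bigcap_measurable => [|q _//]; exists N => /=.
exists (\bigcup_N G N); split.
- exact: bigcupT_measurable.
- have ndG : nondecreasing_seq G.
    move=> N N' NN'; apply/subsetPset => w Gw q /= N'q; apply: Gw.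
    exact: leq_trans NN' N'q.
  have cG : P (G N) @[N --> \oo] --> P (\bigcup_N G N).
    exact: nondecreasing_cvg_mu mG (bigcupT_measurable _ mG) ndG.
  rewrite -(cvg_lim _ cG)//; apply: lime_le.
    by apply/cvg_ex; exists (P (\bigcup_N G N)).
  apply: nearW => N /=; apply: le_trans (PE N).
  by apply: le_measure; rewrite ?inE// => w; apply => /=.
- move=> w cW t0 Ac0 Ma0.
  pose t := Num.min t0 (s n).
  have Ac : sp_bracket t w <= c by rewrite sp_bracket_after.
  have Ma : a < enorm (sp_integral W S t w) by rewrite sp_integral_after.
  have tn : t <= s n by rewrite ge_min lexx orbT.
  have t_gt : s 0%N < t.
    rewrite ltNge; apply/negP => ts; move: Ma; rewrite sp_integral_before//.
    by rewrite enorm0 ltNge ltW.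
  have [i i_n /andP[it ti]] := sp_time_locate t_gt tn.
  have s_i0 := sp_time_ge0 (ltnW i_n).
  have t0' : 0 <= t by apply: le_trans s_i0 (ltW it).
  pose gap := enorm (sp_integral W S t w) - a.
  have gap0 : 0 < gap by rewrite subr_gt0.
  pose K := enorm (coef i w) + 1.
  have K0 : 0 < K by rewrite ltr_wpDl ?enorm_ge0.
  have [dl dl0 Hdl] := within_continuous_enorm cW (t := t)
    (ltac:(by rewrite /= in_itv/= t0')) (divr_gt0 gap0 K0).
  have D0 : 0 < s i.+1 - s i by rewrite subr_gt0 (lt_le_trans it).
  have [N0 _ HN0] : \forall N \near \oo, (s i.+1 - s i) / dl < N%:R.
    exact: nbhs_infty_gtr.
  exists N0 => // q /= N0q; case: (H q) => E /= [_ _ HE].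
  have [k [kn sk kt gk]] := sp_grid_approx (ltn0Sn q) i_n it ti.
  set u := sp_grid q.+1 k in sk kt gk *.
  have ut : `|u - t| < dl.
    rewrite distrC ger0_norm ?subr_ge0//; apply: le_lt_trans gk _.
    rewrite ltr_pdivrMr ?ltr0n// mulrC -ltr_pdivrMr//.
    by apply: lt_trans (HN0 _ N0q) _; rewrite ltr_nat.
  apply: (HE k w kn).
    by apply: le_trans Ac; exact: (sp_bracket_mono w i_n sk kt ti).
  have := sp_integral_increment w i_n sk kt ti => E1.
  have h1 : enorm (coef i w *m (W t w - W u w)) < gap.
    apply: le_lt_trans (enorm_mulmx _ _) _.
    have hu : enorm (W t w - W u w) < gap / K.
      rewrite enorm_distrC; apply: Hdl;
        by rewrite /= ?in_itv/= ?andbT ?(le_trans s_i0).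
    apply: (@le_lt_trans _ _ (K * enorm (W t w - W u w))).
      by rewrite ler_wpM2r ?enorm_ge0// lerDl.
    by rewrite mulrC -ltr_pdivlMr.
  have := enormD (sp_integral W S u w) (coef i w *m (W t w - W u w)).
  rewrite -E1 => h2; move: h1; rewrite /gap; lra.
Qed.

End SimpleProcess.

(** * Measurability of functionals of random vectors and of paths *)

Section MeasurableFunctionals.
Variable R : realType.

(** A function that depends continuously on a random matrix Z, although no
    continuous function of the matrix need be at hand outside the range of Z,
    is measurable: its superlevel sets are countable unions of preimages under
    Z of rational boxes. *)
Lemma measurable_continuous_factor d (T : measurableType d) p n
    (Z : T -> 'M[R]_(p, n)) (psi : T -> R) : mxmeas Z ->
  (forall w e, 0 < e -> exists2 dl, 0 < dl &
    forall w', enorm (Z w' - Z w) < dl -> `|psi w' - psi w| < e) ->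
  measurable_fun setT psi.
Proof.
move=> mZ cpsi.
pose box (v : 'M[rat]_(p, n)) (N : nat) :=
  [set w | forall i j, `|Z w i j - ratr (v i j)| < N.+1%:R^-1].
have mbox v N : measurable (box v N).
  have -> : box v N = \bigcap_(ij in [set: 'I_p * 'I_n])
      [set w | `|Z w ij.1 ij.2 - ratr (v ij.1 ij.2)| < N.+1%:R^-1].
    by apply/seteqP; split => [w H ij _|w H i j]; [exact: H|exact: (H (i, j))].
  apply: fin_bigcap_measurable => // -[i j] _ /=.
  rewrite -[X in measurable X]setTI; apply: (measurable_fun_ltr
    (f := fun w => `|Z w i j - ratr (v i j)|) (g := cst N.+1%:R^-1)) => //.
  by apply: measurableT_comp => //; exact: measurable_funB.
apply: (@measurability _ _ _ _ _ _ (@RGenOInfty.G R)).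
  exact: RGenOInfty.measurableE.
move=> _ [_ [a ->] <-]; rewrite setTI.
pose good vN := forall w', box vN.1 vN.2 w' -> a < psi w'.
pose U k := if unpickle k is Some vN then
  if `[< good vN >] then box vN.1 vN.2 else set0 else set0.
have mU k : measurable (U k).
  by rewrite /U; case: (unpickle k) => // vN; case: ifP.
rewrite (_ : _ @^-1` _ = \bigcup_k U k); first exact: bigcupT_measurable.
apply/seteqP; split => w /=; last first.
  rewrite in_itv/= andbT => -[k _]; rewrite /U.
  by case: (unpickle k) => // vN; case: ifPn => // /asboolP; apply.
rewrite in_itv/= andbT => aw.
have [dl dl0 Hdl] := cpsi w (psi w - a) (ltac:(by rewrite subr_gt0)).
pose e := dl / ((p * n).*2.+1)%:R.
have e0 : 0 < e by rewrite divr_gt0.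
have [N _ HN] : \forall N \near \oo, e^-1 < N%:R by exact: nbhs_infty_gtr.
have Ne : N.+1%:R^-1 < e.
  rewrite -[ltRHS]invrK ltf_pV2 ?posrE ?invr_gt0 ?ltr0n//.
  by apply: HN => /=.
have N1 : 0 < N.+1%:R^-1 :> R by rewrite invr_gt0.
have qx i j : exists q, `|Z w i j - ratr q| < N.+1%:R^-1.
  have [q] := @rat_in_itvoo R (Z w i j) (Z w i j + N.+1%:R^-1)
    (ltac:(by rewrite ltrDl)).
  rewrite in_itv/= => /andP[q1 q2]; exists q.
  by rewrite distrC gtr0_norm ?subr_gt0// ltrBlDl.
pose v : 'M[rat]_(p, n) := \matrix_(i, j) sval (cid (qx i j)).
have wv : box v N w by move=> i j; rewrite mxE; exact: svalP (cid (qx i j)).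
exists (pickle (v, N)) => //; rewrite /U pickleK.
rewrite ifT//; apply/asboolP => w' /= w'v.
suff : `|psi w' - psi w| < psi w - a.
  by rewrite ltr_norml opprB => /andP[]; lra.
apply: Hdl; apply: (@le_lt_trans _ _ ((p * n)%:R * (2 * e))).
  apply: enorm_mx_norm => [|i j]; first by rewrite mulr_ge0 ?ltW.
  have h1 := wv i j; have h2 := w'v i j.
  have h3 := ler_distD (ratr (v i j)) (Z w' i j) (Z w i j).
  rewrite (distrC (ratr (v i j))) in h3.
  rewrite !mxE; apply: le_trans h3 _.
  apply: le_trans (lerD (ltW h2) (ltW h1)) _.
  by rewrite mulr_natl mulr2n lerD// ltW.
have -> : (p * n)%:R * (2 * e) = dl * (((p * n).*2)%:R / ((p * n).*2.+1)%:R).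
  by rewrite /e -muln2 natrM; ring.
by rewrite gtr_pMr// ltr_pdivrMr// mul1r ltr_nat.
Qed.

End MeasurableFunctionals.

Section PathFunctionals.
Context (R : realType) dO (Om : measurableType dO).
Local Notation mu := (@lebesgue_measure R).
Local Notation TR := (measurableTypeR R).

(** The scalar counterpart of mx_path_continuous. *)
Definition path_continuous (a b : R) (h : R -> R) : Prop :=
  forall s e, a <= s <= b -> 0 < e -> exists2 dl, 0 < dl &
    forall u, a <= u <= b -> `|u - s| < dl -> `|h u - h s| < e.

Let slab (T : R) : set (TR * Om) := [set sw | 0 <= sw.1 <= T].

Lemma measurable_slab T : measurable (slab T).
Proof.
have -> : slab T = `[0, T]%classic `*` setT.
  by apply/seteqP; split => [[s w]|[s w] []]/=; rewrite in_itv.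
by apply: measurableX.
Qed.

(** A function that is measurable in the outcome and continuous in time is
    jointly measurable, being the limit of its left-endpoint discretizations. *)
Lemma measurable_caratheodory (T : R) (h : R -> Om -> R) :
  (forall s, 0 <= s <= T -> measurable_fun setT (h s)) ->
  (forall w, path_continuous 0 T (h ^~ w)) ->
  measurable_fun (slab T) (fun sw => h sw.1 sw.2).
Proof.
move=> mh ch.
pose p N (s : R) : R := (Num.truncn (s * N.+1%:R))%:R / N.+1%:R.
have p_bounds N s : 0 <= s ->
    [/\ 0 <= p N s, p N s <= s & s - p N s < N.+1%:R^-1].
  move=> s0; have N0 : 0 < N.+1%:R :> R by rewrite ltr0n.
  have x0 : 0 <= s * N.+1%:R by rewrite mulr_ge0.
  have /andP[h1 h2] := truncn_itv x0.
  split; first by rewrite divr_ge0.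
    by rewrite ler_pdivrMr.
  rewrite /p -[X in X - _](mulfK (lt0r_neq0 N0)) -mulrBl.
  rewrite -[ltRHS]mul1r ltr_pM2r ?invr_gt0//.
  by rewrite ltrBlDl natr1.
apply: (measurable_fun_cvg (h := fun N (sw : TR * Om) => h (p N sw.1) sw.2)).
- move=> N; set D := slab T.
  have N0 : 0 < N.+1%:R :> R by rewrite ltr0n.
  pose E (k : nat) : set (TR * Om) :=
    D `&` (`[k%:R / N.+1%:R, k.+1%:R / N.+1%:R[%classic `*` setT).
  have mE k : measurable (E k).
    by apply: measurableI; [exact: measurable_slab|exact: measurableX].
  have DE : D = \bigcup_k E k.
    apply/seteqP; split => [[s w] Dsw|sw [k _ []]//].
    have /andP[/= s0 _] := Dsw.
    exists (Num.truncn (s * N.+1%:R)) => //; split => //; split => //=.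
    by rewrite in_itv/= ler_pdivrMr// ltr_pdivlMr// truncn_itv// mulr_ge0.
  rewrite DE; apply/measurable_fun_bigcup => // k.
  have pE sw : E k sw -> p N sw.1 = k%:R / N.+1%:R.
    case: sw => s w [/andP[/= s0 _] [/=]].
    rewrite in_itv/= ler_pdivrMr// ltr_pdivlMr// => hk _.
    by rewrite /p (truncn_def hk).
  have [kT|Tk] := leP (k%:R / N.+1%:R) T.
    apply: (eq_measurable_fun (fun sw : TR * Om => h (k%:R / N.+1%:R) sw.2)).
      by move=> sw /[!inE] /pE ->.
    apply: measurable_funTS; apply: measurableT_comp; last exact: measurable_snd.
    by apply: mh; rewrite kT divr_ge0.
  suff -> : E k = set0 by exact: measurable_fun_set0.
  apply/seteqP; split => // -[s w] [/andP[/= _ sT] [/=]].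
  by rewrite in_itv/= => /andP[+ _] _; rewrite leNgt (le_lt_trans sT).
- move=> [s w] /= /andP[s0 sT]; apply/cvgrPdist_lt => e e0.
  have [|dl dl0 Hdl] := ch w s e _ e0; first by rewrite s0.
  near=> N; rewrite distrC; have [h1 h2 h3] := p_bounds N s s0.
  apply: Hdl; first by rewrite h1 (le_trans h2).
  rewrite distrC ger0_norm ?subr_ge0//; apply: lt_trans h3 _.
  near: N; exact: near_infty_natSinv_lt (PosNum dl0).
Unshelve. all: by end_near.
Qed.

(** On an interval, exceeding a level at some time is detected at rational
    fractions of the interval. *)
Lemma measurable_exceed p n (P : probability Om R) (F : R -> set (set Om))
    (N : set Om) (a b eps : R) (Y : R -> Om -> 'M[R]_(p, n)) :
  usual_filtration P F -> P.-negligible N -> a <= b ->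
  (forall t, a <= t <= b -> mxmeas (Y t)) ->
  (forall w, ~ N w -> mx_path_continuous a b (Y ^~ w)) ->
  measurable [set w | exists2 t, a <= t <= b & eps < enorm (Y t w)].
Proof.
move=> filtF N0 ab mY cY.
pose g (l k : nat) : R := a + (b - a) * (k%:R / l.+1%:R).
have g_in l k : (k <= l.+1)%N -> a <= g l k <= b.
  move=> kl; have f0 : 0 <= (k%:R / l.+1%:R : R) by rewrite divr_ge0.
  have f1 : (k%:R / l.+1%:R : R) <= 1 by rewrite ler_pdivrMr// mul1r ler_nat.
  rewrite /g; move: (_ / _) f0 f1 => f f0 f1; apply/andP; split; nra.
pose U l k :=
  if (k <= l.+1)%N then [set w | eps < enorm (Y (g l k) w)] else set0.
have mU l k : measurable (U l k).
  rewrite /U; case: ifP => // kl; apply: measurable_enorm_gt.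
  exact/mY/g_in.
apply: (measurable_ae_eq filtF (A := \bigcup_l \bigcup_k U l k) N0).
  by apply: bigcupT_measurable => l; exact: bigcupT_measurable.
move=> w Nw; split.
  move=> [l _ [k _]]; rewrite /U; case: ifP => // kl /= h.
  by exists (g l k) => //; exact: g_in.
move=> [t tab et].
have [dl dl0 Hdl] := cY w Nw t (enorm (Y t w) - eps) tab
  (ltac:(by rewrite subr_gt0)).
have [l _ Hl] : \forall l \near \oo, (b - a) / dl < l%:R.
  exact: nbhs_infty_gtr.
have ldl : (b - a) / l.+1%:R < dl.
  rewrite ltr_pdivrMr// mulrC -ltr_pdivrMr//.
  by apply: lt_trans (Hl l _) _ => //=; rewrite ltr_nat.
have [ta tb] := andP tab.
have [ab_eq|ab_lt] := leP b a.
  exists l => //; exists 0%N => //; rewrite /U/= /g mul0r mulr0 addr0.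
  suff -> : a = t by [].
  by apply/le_anti; rewrite ta (le_trans tb).
have ba0 : 0 < b - a by rewrite subr_gt0.
pose x := (t - a) / (b - a) * l.+1%:R.
have x0 : 0 <= x by rewrite mulr_ge0// divr_ge0 ?subr_ge0// ltW.
pose k := Num.truncn x.
have /andP[kx xk] : k%:R <= x < k.+1%:R by exact: truncn_itv.
have l0 : 0 < l.+1%:R :> R by rewrite ltr0n.
have tE : t = a + (b - a) * (x / l.+1%:R).
  by rewrite /x; field; rewrite !gt_eqF// ltr0n.
have kl : (k <= l.+1)%N.
  rewrite -(ler_nat R) (le_trans kx)// /x ler_piMl// ?(ltW l0)//.
  by rewrite ler_pdivrMr// mul1r lerD2r.
exists l => //; exists k => //; rewrite /U kl /=.
have : enorm (Y (g l k) w - Y t w) < enorm (Y t w) - eps.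
  apply: Hdl; first exact: g_in.
  rewrite distrC {1}tE /g opprD addrACA subrr add0r -mulrBr -mulrBl.
  rewrite ger0_norm; last first.
    by rewrite !mulr_ge0 ?invr_ge0 ?subr_ge0// ltW.
  apply: le_lt_trans ldl; rewrite ler_wpM2l ?(ltW ba0)//.
  rewrite -[leRHS]mul1r ler_wpM2r ?invr_ge0 ?(ltW l0)//.
  by rewrite lerBlDl natr1 ltW.
have := ler_enorm_dist (Y (g l k) w) (Y t w).
rewrite ler_norml => /andP[h1 _] h2; lra.
Qed.

(** Tonelli's theorem for the integrand extended by 0 outside the time slab. *)
Lemma measurable_time_integral (T : R) (h : R -> Om -> R) :
  measurable_fun (slab T) (fun sw => h sw.1 sw.2) ->
  (forall s w, 0 <= h s w) ->
  measurable_fun setT (fun w => \int[mu]_(s in `[0%R, T]) (h s w)%:E)%E.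
Proof.
move=> mh h0.
pose f := (fun sw : TR * Om => (h sw.1 sw.2)%:E) \_ (slab T).
have mf : measurable_fun setT f.
  apply/(measurable_restrictT _ (measurable_slab T)).
  exact/measurable_EFinP.
have f0 sw : (0 <= f sw)%E.
  by rewrite /f patchE; case: ifP => // _; rewrite lee_fin.
have : measurable_fun setT (fubini_G mu f).
  exact: measurable_fun_fubini_tonelli_G.
congr (measurable_fun _ _); apply/funext => w.
rewrite /fubini_G [RHS]integral_mkcond; apply: eq_integral => s _.
by rewrite /f !patchE; congr (if _ then _ else _).
Qed.

Lemma measurable_time_Rintegral (T : R) (h : R -> Om -> R) :
  measurable_fun (slab T) (fun sw => h sw.1 sw.2) ->
  measurable_fun setT (fun w => (\int[mu]_(s in `[0, T]) h s w)%R).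
Proof.
move=> mh; rewrite /Rintegral.
apply: (measurableT_comp (f := @fine R)).
  exact: fine_measurable.
under eq_fun do rewrite integralE.
apply: emeasurable_funB.
  rewrite (_ : (fun w => _) =
      (fun w => \int[mu]_(s in `[0%R, T]) (Num.max (h s w) 0%R)%:E)%E).
    apply: measurable_time_integral; last by move=> s w; rewrite le_max lexx orbT.
    exact: measurable_funrpos.
  apply/funext => w; apply: eq_integral => s _.
  by rewrite (funeposE, funenegE) EFin_max.
rewrite (_ : (fun w => _) =
    (fun w => \int[mu]_(s in `[0%R, T]) (Num.max (- h s w)%R 0%R)%:E)%E).
  apply: measurable_time_integral; last by move=> s w; rewrite le_max lexx orbT.
  exact: measurable_funrneg.
apply/funext => w; apply: eq_integral => s _.
by rewrite (funeposE, funenegE) EFin_max.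
Qed.

End PathFunctionals.

(** * A maximal inequality for the stochastic integral *)

Lemma sup_enorm_gtE (R : realType) p n (A : set R) (y : R -> 'M[R]_(p, n))
    (eps : R) :
  (eps%:E < ereal_sup [set (enorm (y t))%:E | t in A])%E <->
  exists2 t, A t & eps < enorm (y t).
Proof.
split=> [/ereal_sup_gtP[_ [t At <-]]|[t At et]].
  by rewrite lte_fin => et; exists t.
by apply/ereal_sup_gtP; exists (enorm (y t))%:E; rewrite ?lte_fin//; exists t.
Qed.

Section ItoIntegral.
Context (R : realType) dO (Om : measurableType dO) (P : probability Om R).
Variable F : R -> set (set Om).
Variables (m d : nat) (W : R -> Om -> 'cV[R]_m).
Hypothesis filtF : usual_filtration P F.
Local Notation mu := (@lebesgue_measure R).
Local Notation TR := (measurableTypeR R).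

Section OneSimpleProcess.
Variable S : simple_process F d m.
Local Notation n := (sp_size S).
Local Notation s := (sp_time S).
Local Notation coef := (sp_coef S).

Let piece (i : nat) (w : Om) (u : R) : R :=
  enorm (coef i w) ^+ 2 * (s i < u <= s i.+1)%R%:R.

(* At any time at most one of the intervals is active. *)
Let sum_piece_le u w : \sum_(i < n) piece i w u <= enorm (sp_val S u w) ^+ 2.
Proof.
have [[i iu]|no] := pselect (exists i : 'I_n, s i < u <= s i.+1).
  have out (j : 'I_n) : j != i -> (s j < u <= s j.+1) = false.
    have /andP[iu1 iu2] := iu.
    rewrite neq_ltn => /orP[ji|ij]; apply/negP => /andP[ju1 ju2].
      have : s j.+1 <= s i by apply: sp_time_mono => //; exact: ltnW.
      by rewrite leNgt (lt_le_trans iu1).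
    have : s i.+1 <= s j by apply: sp_time_mono => //; exact: ltnW.
    by rewrite leNgt (lt_le_trans ju1).
  rewrite (bigD1 i)//= big1 => [|j ji]; last by rewrite /piece out// mulr0.
  rewrite /sp_val (bigD1 i)//= big1 => [|j ji]; last by rewrite out// scale0r.
  by rewrite /piece iu mulr1 scale1r !addr0.
rewrite big1 ?sqr_ge0// => i _; rewrite /piece.
have [iu|_] := boolP (s i < u <= s i.+1); last by rewrite mulr0.
by exfalso; apply: no; exists i.
Qed.

Let measurable_piece i w : measurable_fun setT (piece i w : TR -> R).
Proof.
rewrite /piece; apply: measurable_funM; first exact: measurable_cst.
have -> : (fun u => (s i < u <= s i.+1)%R%:R) =
    \1_(`]s i, s i.+1]%classic : set R) :> (R -> R).
  by apply/funext => u; rewrite indicE mem_setE in_itv.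
exact: measurable_indic.
Qed.

Lemma measurable_sp_val_path w :
  measurable_fun setT ((fun u => enorm (sp_val S u w) ^+ 2) : TR -> R).
Proof.
apply: measurable_enorm_sqr => i j; under eq_fun do rewrite summxE.
apply: measurable_sum => k; under eq_fun do rewrite mxE.
apply: measurable_funM; last exact: measurable_cst.
have -> : (fun u => (s k < u <= s k.+1)%R%:R) =
    \1_(`]s k, s k.+1]%classic : set R) :> (R -> R).
  by apply/funext => u; rewrite indicE mem_setE in_itv.
exact: measurable_indic.
Qed.

Lemma sp_bracket_le_sq_int t w : 0 <= t ->
  ((sp_bracket S t w)%:E <= sq_int (sp_val S) t w)%E.
Proof.
move=> t0.
apply: (@le_trans _ _
    (\int[mu]_(u in `[0%R, t]) (\sum_(i < n) (piece i w u)%:E))%E); last first.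
  apply: ge0_le_integral => //.
  - by move=> u _; apply: sume_ge0 => i _; rewrite lee_fin mulr_ge0// sqr_ge0.
  - apply: emeasurable_sum => i.
    by apply/measurable_EFinP; apply: measurable_funTS; exact: measurable_piece.
  - by apply/measurable_EFinP; apply: measurable_funTS; exact: measurable_sp_val_path.
  - by move=> u _; rewrite sumEFin lee_fin; exact: sum_piece_le.
rewrite ge0_integral_sum//; last 2 first.
- by move=> i; apply/measurable_EFinP; apply: measurable_funTS; exact: measurable_piece.
- by move=> i u _; rewrite lee_fin mulr_ge0// sqr_ge0.
rewrite /sp_bracket -sumEFin; apply: lee_sum => i _.
have iE u : (piece i w u)%:E =
    ((enorm (coef i w) ^+ 2)%:E * (\1_(`]s i, s i.+1]%classic : set R) u)%:E)%E.
  by rewrite /piece indicE mem_setE in_itv EFinM.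
under eq_integral do rewrite iE.
rewrite ge0_integralZl_EFin ?sqr_ge0//; last first.
  by apply/measurable_EFinP; exact: measurable_indic.
rewrite EFinM; apply: lee_wpmul2l; first by rewrite lee_fin sqr_ge0.
rewrite integral_indic//.
have si0 : 0 <= s i by apply: sp_time_ge0; exact: ltnW.
have -> : (`]s i, s i.+1] `&` `[0, t])%classic =
    `]s i, Num.min (s i.+1) t]%classic :> set R.
  apply/seteqP; split => u /=; rewrite !in_itv/= le_min.
    by move=> [/andP[-> ->] /andP[_ ->]].
  move=> /andP[h /andP[-> ->]]; rewrite h; split => //.
  by rewrite (le_trans si0 (ltW h)).
rewrite [leRHS]lebesgue_measure_itv/= lte_fin.
case: ifPn => [h|].
  rewrite -EFinB lee_fin lerB// le_min lexx/=.
  by move: h; rewrite lt_min => /andP[_ /ltW].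
rewrite -leNgt lee_fin subr_le0 => h.
by rewrite le_min h ge_min lexx orbT.
Qed.

Section Approximation.
Variables (H : R -> Om -> 'M[R]_(d, m)) (T : R).
Hypotheses (progH : progressive F H) (T0 : 0 <= T).

Let joint_diff : measurable_fun ([set sw | 0 <= sw.1 <= T] : set (TR * Om))
  (fun sw => enorm (sp_val S sw.1 sw.2 - H sw.1 sw.2) ^+ 2).
Proof.
apply: (eq_measurable_fun (fun sw : TR * Om => \sum_i \sum_j
    (sp_val S sw.1 sw.2 i j - H sw.1 sw.2 i j) ^+ 2)).
  move=> sw _; rewrite enorm_sqr; apply: eq_bigr => i _; apply: eq_bigr => j _.
  by rewrite !mxE.
apply: measurable_sum => i; apply: measurable_sum => j.
apply: measurable_funX; apply: measurable_funB.
  apply: measurable_funTS; under eq_fun do rewrite summxE.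
  apply: measurable_sum => k; under eq_fun do rewrite mxE.
  apply: measurable_funM.
    have -> : (fun sw : TR * Om => (s k < sw.1 <= s k.+1)%R%:R) =
        (\1_(`]s k, s k.+1]%classic : set R) : TR -> R) \o fst :> (TR * Om -> R).
      by apply/funext => u; rewrite /= indicE mem_setE in_itv.
    by apply: measurableT_comp => //; exact: measurable_indic.
  apply: (measurableT_comp (f := fun w => coef k w i j)) => //.
  have k0 : 0 <= s k by apply: sp_time_ge0; exact: ltnW.
  apply: (mxmeas_past_ambient filtF k0); apply: (mxmeas_past filtF k0).
  exact: sp_coef_meas.
move=> _ A mA; have := progH T0 i j mA.
have -> : [set sw | 0 <= sw.1 <= T /\ A (H sw.1 sw.2 i j)] =
    [set sw : TR * Om | 0 <= sw.1 <= T] `&` (fun sw => H sw.1 sw.2 i j) @^-1` A.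
  by apply/seteqP; split.
apply: smallest_sub; first exact: sigma_algebra_measurable.
move=> _ [B [C [mB FC ->]]]; apply: measurableX => //.
exact: (filt_sub filtF T0).
Qed.

(** The events used to compare a simple process with the integrand are
    measurable, by Tonelli's theorem and progressive measurability. *)
Lemma measurable_sq_int_diff :
  measurable_fun setT (sq_int (fun u w => sp_val S u w - H u w) T).
Proof.
apply: (measurable_time_integral
  (h := fun u w => enorm (sp_val S u w - H u w) ^+ 2)).
  exact: joint_diff.
by move=> u w; exact: sqr_ge0.
Qed.

Let path_diff w : measurable_fun `[0, T]
  ((fun u => enorm (sp_val S u w - H u w) ^+ 2) : TR -> R).
Proof.
apply: (measurable_comp (F := [set sw : TR * Om | 0 <= sw.1 <= T])
  (f := fun sw => enorm (sp_val S sw.1 sw.2 - H sw.1 sw.2) ^+ 2)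
  (g := fun u : TR => (u, w))).
- exact: measurable_slab.
- by move=> _ [u /= + <-]; rewrite in_itv.
- exact: joint_diff.
- by apply: measurable_funTS; exact: pair2_measurable.
Qed.

(** The bracket of the simple process is controlled before the integrand has
    exceeded K, from |S| ^ 2 <= 2 |S - H| ^ 2 + 2 |H| ^ 2. *)
Lemma sp_bracket_le_approx (K t : R) w : 0 <= K -> 0 <= t <= T ->
  (forall u, 0 <= u <= t -> enorm (H u w) ^+ 2 <= K) ->
  ((sp_bracket S t w)%:E <=
   2%:E * sq_int (fun u w' => (sp_val S u w' - H u w')%R) T w +
   (2 * K * t)%:E)%E.
Proof.
move=> K0 /andP[t0 tT] HK; apply: le_trans (sp_bracket_le_sq_int w t0) _.
have sub : `[0, t] `<=` (`[0, T] : set R).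
  by move=> u /=; rewrite !in_itv/= => /andP[-> ut]; exact: le_trans ut tT.
have mD : measurable_fun `[0, t]
    ((fun u => (enorm (sp_val S u w - H u w)%R ^+ 2)%:E) : TR -> \bar R).
  by apply/measurable_EFinP; apply: measurable_funS (path_diff w).
apply: (@le_trans _ _ (\int[mu]_(u in `[0%R, t])
    (2%:E * (enorm (sp_val S u w - H u w)%R ^+ 2)%:E + (2 * K)%:E))%E).
  apply: ge0_le_integral => //.
  - by move=> u _; rewrite lee_fin sqr_ge0.
  - by apply/measurable_EFinP; apply: measurable_funTS; exact: measurable_sp_val_path.
  - apply: emeasurable_funD; last exact: measurable_cst.
    by apply: emeasurable_funM => //; exact: measurable_cst.
  - move=> u; rewrite /= in_itv/= => /HK HuK; rewrite -EFinM -EFinD lee_fin.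
    have := enormD_sqr (sp_val S u w - H u w) (H u w); rewrite subrK.
    by move=> /le_trans; apply; rewrite lerD2l ler_pM2l.
rewrite ge0_integralD//; last 3 first.
- by move=> u _; rewrite mule_ge0// lee_fin sqr_ge0.
- by apply: emeasurable_funM => //; exact: measurable_cst.
- by move=> u _; rewrite lee_fin mulr_ge0.
apply: leeD; last first.
  rewrite [X in (X <= _)%E](integral_cst _ _ (2 * K)%:E)//.
  rewrite [X in (_ * X <= _)%E]lebesgue_measure_itv/= lte_fin.
  case: ifPn => [_|]; first by rewrite sube0 -EFinM.
  by rewrite -leNgt mule0 lee_fin !mulr_ge0.
rewrite ge0_integralZl_EFin//; last by move=> u _; rewrite lee_fin sqr_ge0.
apply: lee_wpmul2l; first by rewrite lee_fin.
apply: ge0_subset_integral => //.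
- by apply/measurable_EFinP; exact: path_diff.
- by move=> u _; rewrite lee_fin sqr_ge0.
Qed.

End Approximation.

Lemma sp_integral_continuous (T : R) w :
  {within `[0, +oo[, continuous (W ^~ w)} ->
  mx_path_continuous 0 T (sp_integral W S ^~ w).
Proof.
move=> cW; apply: mx_path_continuous_sum => i.
have cW' : mx_path_continuous 0 T (W ^~ w).
  apply: within_mx_path_continuous cW _ => t /andP[t0 _].
  by rewrite /= in_itv/= t0.
apply: mx_path_continuousM; apply: mx_path_continuousB;
  apply: (mx_path_continuous_min _ cW'); apply: sp_time_ge0 => //.
exact: ltnW.
Qed.

Lemma measurable_sp_integral (bmW : brownian_motion P F W) (t : R) : 0 <= t ->
  mxmeas (sp_integral W S t).
Proof.
move=> t0; rewrite /sp_integral; apply: mxmeas_sum => i.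
have i0 : 0 <= s i by apply: sp_time_ge0; exact: ltnW.
have i1 : 0 <= s i.+1 by exact: sp_time_ge0.
apply: mxmeasM.
  apply: (mxmeas_past_ambient filtF i0); apply: (mxmeas_past filtF i0).
  exact: sp_coef_meas.
by apply: mxmeasB; apply: (bm_mxmeas filtF bmW); rewrite le_min t0 ?i0 ?i1.
Qed.

End OneSimpleProcess.

End ItoIntegral.

Section ItoMaximalInequality.
Context (R : realType) dO (Om : measurableType dO) (P : probability Om R).
Variable F : R -> set (set Om).
Variables (m d : nat) (W : R -> Om -> 'cV[R]_m).
Hypothesis filtF : usual_filtration P F.
Hypothesis bmW : brownian_motion P F W.
Variables (H : R -> Om -> 'M[R]_(d, m)) (I : R -> Om -> 'cV[R]_d).
Hypothesis itoI : ito_integral P F W H I.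

Lemma ae_negligible (Q : Om -> Prop) :
  {ae P, forall w, Q w} -> P.-negligible [set w | ~ Q w].
Proof. by []. Qed.

Lemma cvg0_small (u : nat -> \bar R) (e : R) : 0 < e ->
  u n @[n --> \oo] --> 0%E -> \forall n \near \oo, (u n < e%:E)%E.
Proof.
move=> e0 cu; apply: (cu [set x | (x < e%:E)%E]).
by apply: open_ereal_lt'; rewrite lte_fin.
Qed.

(** The probability that the integral exceeds a before the energy density of
    its integrand has exceeded K.  The integral is first replaced by that of a
    simple process; eta pays for the replacement. *)
Lemma ito_maximal_inequality (T a K eta : R) :
  0 < T -> 0 < a -> 0 <= K -> 0 < eta ->
  (forall t, 0 <= t <= T -> mxmeas (I t)) ->
  exists E : set Om,
  [/\ measurable E,
      (P E <= (64 * m%:R * (K + 1) * T / a ^+ 2 + eta)%:E)%E &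
   forall w, ~ E w -> forall t, 0 <= t <= T ->
     (forall u, 0 <= u <= t -> enorm (H u w) ^+ 2 <= K) ->
     enorm (I t w) <= a].
Proof.
move=> T0 a0 K0 eta0 mI.
have a20 : 0 < a / 2 by rewrite divr_gt0.
have eta20 : 0 < eta / 2 by rewrite divr_gt0.
have [S approx] := ito_approx itoI.
have c1 := cvg0_small eta20 (proj1 (approx T T (ltW T0) T0)).
have c2 := cvg0_small eta20 (proj2 (approx T (a / 2) (ltW T0) a20)).
have [n [P1 P2]] : exists n,
   (P [set w | (T%:E <
      sq_int (fun s w' => (sp_val (S n) s w' - H s w')%R) T w)%E]
      < (eta / 2)%:E)%E /\
   (P [set w | ((a / 2)%:E < ereal_sup
      [set (enorm (sp_integral W (S n) t w - I t w)%R)%:E | t in `[0%R, T]])%E]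
      < (eta / 2)%:E)%E.
  by have [n [? ?]] := filter_ex (filterI c1 c2); exists n.
set E1 := [set w | _] in P1; set E2 := [set w | _] in P2.
have c0 : 0 <= 2 * (K + 1) * T by rewrite !mulr_ge0 ?addr_ge0// ltW.
have [E3 [mE3 P3 HE3]] := sp_maximal_inequality (S n) filtF bmW a20 c0.
have NW := ae_negligible (bm_continuous bmW).
have NI := ae_negligible (ito_continuous itoI).
set E4 := [set w | _] in NW; set E5 := [set w | _] in NI.
have mE1 : measurable E1.
  rewrite -[X in measurable X]setTI; apply: emeasurable_fun_o_infty => //.
  exact: (measurable_sq_int_diff filtF (S n) (ito_progressive itoI) (ltW T0)).
have mE2 : measurable E2.
  have -> : E2 = [set w | exists2 t, 0 <= t <= T &
      a / 2 < enorm (sp_integral W (S n) t w - I t w)].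
    apply/seteqP; split => w.
      by move=> /sup_enorm_gtE[t]; rewrite /= in_itv/= => tT h; exists t.
    by move=> [t tT h]; apply/sup_enorm_gtE; exists t; rewrite //= in_itv.
  apply: (measurable_exceed (Y := fun t w => sp_integral W (S n) t w - I t w)
    (a / 2) filtF (negligibleU NW NI) (ltW T0)).
    move=> t tT; apply: mxmeasB; last exact: mI.
    by apply: (measurable_sp_integral filtF (S n) bmW); case/andP: tT.
  move=> w /not_orP[/contrapT cW /contrapT cI].
  apply: mx_path_continuousB; first exact: sp_integral_continuous.
  apply: within_mx_path_continuous cI _ => t /andP[t0 _].
  by rewrite /= in_itv/= t0.
have mE4 := negligible_measurable filtF NW.
have mE5 := negligible_measurable filtF NI.
have m12 := measurableU _ _ mE1 mE2; have m123 := measurableU _ _ m12 mE3.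
have m1234 := measurableU _ _ m123 mE4.
exists (E1 `|` E2 `|` E3 `|` E4 `|` E5); split.
- exact: measurableU.
- apply: le_trans (measureU2 _ m1234 mE5) _.
  rewrite [X in (_ + X)%E](measure_negligible mE5 NI) adde0.
  apply: le_trans (measureU2 _ m123 mE4) _.
  rewrite [X in (_ + X)%E](measure_negligible mE4 NW) adde0.
  apply: le_trans (measureU2 _ m12 mE3) _.
  have -> : 64 * m%:R * (K + 1) * T / a ^+ 2 + eta =
      (eta / 2 + eta / 2) + 8 * m%:R * (2 * (K + 1) * T) / (a / 2) ^+ 2.
    by field; rewrite gt_eqF.
  rewrite EFinD; apply: leeD => //.
  apply: le_trans (measureU2 _ mE1 mE2) _.
  by rewrite EFinD; apply: leeD; exact: ltW.
- move=> w nE t tT HK.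
  have [nE1 nE2 nE3 nE4] : [/\ ~ E1 w, ~ E2 w, ~ E3 w & ~ E4 w].
    by split => h; apply: nE; do ?[by right|left].
  have /andP[t0 tT'] := tT.
  have h1 : (sq_int (fun s w' => (sp_val (S n) s w' - H s w')%R) T w <= T%:E)%E.
    by rewrite leNgt; apply/negP.
  have h2 : enorm (sp_integral W (S n) t w - I t w) <= a / 2.
    rewrite leNgt; apply/negP => h; apply: nE2; apply/sup_enorm_gtE.
    by exists t => //; rewrite /= in_itv.
  have h3 : sp_bracket (S n) t w <= 2 * (K + 1) * T.
    rewrite -lee_fin; apply: le_trans
      (sp_bracket_le_approx filtF (S n) (ito_progressive itoI) (ltW T0) K0 tT HK) _.
    have -> : 2 * (K + 1) * T = 2 * T + 2 * K * T by ring.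
    rewrite [X in (_ <= X)%E]EFinD; apply: leeD.
      by rewrite [X in (_ <= X)%E]EFinM; apply: lee_wpmul2l; rewrite ?lee_fin.
    by rewrite lee_fin ler_wpM2l// mulr_ge0.
  have h4 : enorm (sp_integral W (S n) t w) <= a / 2.
    rewrite leNgt; apply/negP => h; apply: nE3; apply: (HE3 w _ t h3 h).
    exact: contrapT nE4.
  have := enorm_le_trans (I t w) (sp_integral W (S n) t w) 0.
  rewrite !subr0 enorm_distrC => /le_trans; apply.
  by rewrite (splitr a); apply: lerD.
Qed.

End ItoMaximalInequality.

(** * Locally Lipschitz coefficients *)

Section LocallyLipschitz.
Variables (R : realType) (d p n : nat).
Variable h : 'cV[R]_d -> 'cV[R]_d -> 'M[R]_(p, n).

Definition locally_lipschitz : Prop := forall rho : R, exists2 L, 0 <= L &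
  forall x x' y y', enorm x <= rho -> enorm x' <= rho ->
    enorm y <= rho -> enorm y' <= rho ->
    enorm (h x y - h x' y') <= L * (enorm (x - x') + enorm (y - y')).

Hypothesis lip : locally_lipschitz.

Lemma locally_lipschitz_bounded (rho : R) : 0 <= rho -> exists2 K, 0 <= K &
  forall x y, enorm x <= rho -> enorm y <= rho -> enorm (h x y) <= K.
Proof.
move=> rho0; have [L L0 HL] := lip rho.
exists (enorm (h 0 0) + L * (rho + rho)).
  by rewrite addr_ge0 ?enorm_ge0// mulr_ge0// addr_ge0.
move=> x y xr yr; have := HL x 0 y 0 xr _ yr _; rewrite enorm0 !subr0.
move=> /(_ rho0 rho0) h1.
have := enormD (h x y - h 0 0) (h 0 0); rewrite subrK => /le_trans; apply.
rewrite addrC lerD2l; apply: le_trans h1 _.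
by rewrite ler_wpM2l// lerD.
Qed.

Lemma locally_lipschitz_near (x y : 'cV[R]_d) (e : R) : 0 < e ->
  exists2 dl, 0 < dl & forall x' y', enorm (x' - x) < dl ->
    enorm (y' - y) < dl -> enorm (h x' y' - h x y) < e.
Proof.
move=> e0; pose rho := enorm x + enorm y + 1.
have x0 := enorm_ge0 x; have y0 := enorm_ge0 y.
have [L L0 HL] := lip rho.
pose D := 2 * (L + 1).
have D0 : 0 < D by rewrite mulr_gt0// ltr_wpDl.
exists (Num.min 1 (e / D)); first by rewrite lt_min ltr01 divr_gt0.
move=> x' y'; rewrite !lt_min => /andP[x1 xe] /andP[y1 ye].
have x'r : enorm x' <= rho.
  have := enormD (x' - x) x; rewrite subrK => /le_trans; apply.
  by rewrite /rho; lra.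
have y'r : enorm y' <= rho.
  have := enormD (y' - y) y; rewrite subrK => /le_trans; apply.
  by rewrite /rho; lra.
have xr : enorm x <= rho by rewrite /rho; lra.
have yr : enorm y <= rho by rewrite /rho; lra.
apply: le_lt_trans (HL _ _ _ _ x'r xr y'r yr) _.
apply: (@le_lt_trans _ _ (L * (e / D + e / D))).
  by rewrite ler_wpM2l// lerD// ltW.
have -> : L * (e / D + e / D) = e * (L / (L + 1)).
  by rewrite /D; field; rewrite gt_eqF// ltr_wpDl.
by rewrite gtr_pMr// ltr_pdivrMr ?ltr_wpDl// mul1r ltrDl.
Qed.

Lemma measurable_locally_lipschitz dT (T : measurableType dT)
    (Z : T -> 'cV[R]_d) (y : 'cV[R]_d) :
  mxmeas Z -> mxmeas (fun w => h (Z w) y).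
Proof.
move=> mZ i j; apply: (measurable_continuous_factor mZ) => w e e0.
have [dl dl0 H] := locally_lipschitz_near (Z w) y e0.
exists dl => // w' ww'.
apply: le_lt_trans (H _ y ww' _); last by rewrite subrr enorm0.
by have := le_coord_enorm (h (Z w') y - h (Z w) y) i j; rewrite !mxE.
Qed.

Lemma path_continuous_locally_lipschitz a b (y z : R -> 'cV[R]_d) i j :
  mx_path_continuous a b y -> mx_path_continuous a b z ->
  path_continuous a b (fun s => h (y s) (z s) i j).
Proof.
move=> cy cz s e sab e0.
have [dl dl0 H] := locally_lipschitz_near (y s) (z s) e0.
have [d1 d10 H1] := cy s dl sab dl0; have [d2 d20 H2] := cz s dl sab dl0.
exists (Num.min d1 d2) => [|u uab]; first by rewrite lt_min d10.
rewrite lt_min => /andP[u1 u2].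
apply: le_lt_trans (H _ _ (H1 u uab u1) (H2 u uab u2)).
by have := le_coord_enorm (h (y u) (z u) - h (y s) (z s)) i j; rewrite !mxE.
Qed.

End LocallyLipschitz.

(** * The solution for small times *)

(** The hitting time is the supremum of the times up to which phi has not
    exceeded c. *)
Lemma path_continuous_hitting (R : realType) (T c : R) (phi : R -> R) :
  path_continuous 0 T phi -> 0 <= T -> phi 0 < c -> c < phi T ->
  exists t, [/\ 0 <= t <= T, phi t = c & forall s, 0 <= s <= t -> phi s <= c].
Proof.
move=> cphi T0 phi0 phiT.
pose A := [set t | 0 <= t <= T /\ forall s, 0 <= s <= t -> phi s <= c].
have A0 : A 0.
  split; first by rewrite lexx.
  by move=> s /le_anti <-; exact: ltW.
have ubA : ubound A T by move=> t [/andP[]].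
have supA : has_sup A by split; [exists 0|exists T].
pose t := sup A.
have t0 : 0 <= t by exact: (sup_upper_bound supA A0).
have tT : t <= T by exact: ge_sup (proj1 supA) ubA.
have below s : 0 <= s -> s < t -> phi s <= c.
  move=> s0 st; have ts : 0 < t - s by rewrite subr_gt0.
  have [u [uT Hu] su] := sup_adherent ts supA.
  by apply: Hu; rewrite s0 ltW//; move: su; rewrite -/t; lra.
have tin : 0 <= t <= T by rewrite t0.
have phit : phi t = c.
  apply/eqP; rewrite eq_le; apply/andP; split; rewrite leNgt; apply/negP => h.
    have [dl dl0 H] := cphi t (phi t - c) tin (ltac:(by rewrite subr_gt0)).
    have t_gt0 : 0 < t.
      rewrite lt_neqAle t0 andbT; apply/eqP => t0'; move: h.
      by rewrite -t0' ltNge ltW.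
    pose u := Num.max 0 (t - dl / 2).
    have ut : u < t by rewrite /u gt_max t_gt0 ltrBlDr ltrDl divr_gt0.
    have u0 : 0 <= u by rewrite /u le_max lexx.
    have := H u (ltac:(by rewrite u0 (le_trans (ltW ut)))) .
    have -> : `|u - t| < dl.
      rewrite distrC ger0_norm ?subr_ge0 ?ltW//.
      have : t - dl / 2 <= u by rewrite /u le_max lexx orbT.
      by lra.
    move=> /(_ isT); rewrite ltr_norml => /andP[h1 _].
    by have := below u u0 ut; lra.
  have [dl dl0 H] := cphi t (c - phi t) tin (ltac:(by rewrite subr_gt0)).
  have tT' : t < T.
    rewrite lt_neqAle tT andbT; apply/eqP => tT'; move: h.
    by rewrite tT' ltNge ltW.
  pose u := Num.min T (t + dl / 2).
  have tu : t < u by rewrite /u lt_min tT' ltrDl divr_gt0.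
  have uT : u <= T by rewrite /u ge_min lexx.
  have ud : u <= t + dl / 2 by rewrite /u ge_min lexx orbT.
  have : A u.
    split; first by rewrite (le_trans t0 (ltW tu)).
    move=> s /andP[s0 su]; have [st|ts] := ltP s t; first exact: below.
    have := H s (ltac:(by rewrite s0 (le_trans su))).
    have -> : `|s - t| < dl by rewrite ger0_norm ?subr_ge0//; lra.
    by move=> /(_ isT); rewrite ltr_norml => /andP[_ h2]; lra.
  by move=> /(sup_upper_bound supA); rewrite -/t leNgt tu.
exists t; split => // s /andP[s0]; rewrite le_eqVlt => /orP[/eqP->|st].
  by rewrite phit.
exact: below.
Qed.

Lemma sup_ball_bound (R : realType) d (tau r : R) (xi : R -> 'cV[R]_d) th :
  sup_ball tau r xi -> - tau <= th <= 0 -> enorm (xi th) <= r.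
Proof.
move=> [_ xir] th0; rewrite -lee_fin; apply: le_trans xir.
by apply: ereal_sup_ubound; exists th; rewrite //= in_itv.
Qed.

Section SmallTimeSolution.
Context (R : realType) dO (Om : measurableType dO) (P : probability Om R).
Variable F : R -> set (set Om).
Variables (m d : nat) (W : R -> Om -> 'cV[R]_m) (tau : R).
Variables (f : 'cV[R]_d -> 'cV[R]_d -> 'cV[R]_d).
Variables (g : 'cV[R]_d -> 'cV[R]_d -> 'M[R]_(d, m)).
Hypothesis filtF : usual_filtration P F.
Hypothesis bmW : brownian_motion P F W.
Hypothesis tau0 : 0 < tau.
Hypothesis lip_f : locally_lipschitz f.
Hypothesis lip_g : locally_lipschitz g.
Local Notation mu := (@lebesgue_measure R).

Section OneSolution.
Variables (xi : R -> 'cV[R]_d) (x : R -> Om -> 'cV[R]_d).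
Hypothesis sol : sdde_solution P F W tau f g xi x.

Lemma solution_mxmeas t : 0 <= t -> mxmeas (x t).
Proof.
move=> t0; apply: (mxmeas_past_ambient filtF t0); apply: (mxmeas_past filtF t0).
exact: (sol_adapted sol).
Qed.

Lemma solution_path_continuous a b w : - tau <= a ->
  mx_path_continuous a b (x ^~ w).
Proof.
move=> ta; have cx := @sol_continuous _ _ _ _ _ _ _ _ _ _ _ _ _ sol w.
apply: (within_mx_path_continuous cx).
by move=> t /andP[at_ _]; rewrite /= in_itv/= andbT (le_trans ta).
Qed.

Lemma solution_delay s w : 0 <= s <= tau -> x (s - tau) w = xi (s - tau).
Proof.
move=> /andP[s0 st]; apply: (sol_initial sol).
by rewrite lerBrDr addNr s0 subr_le0.
Qed.

Let delay_continuous T w : T <= tau ->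
  mx_path_continuous 0 T (fun s => x (s - tau) w).
Proof.
move=> Tt t e /andP[t0 tT] e0.
have [|dl dl0 H] := @solution_path_continuous (- tau) 0 w (lexx _) (t - tau) e _ e0.
  by rewrite lerBrDr addNr t0 subr_le0 (le_trans tT).
exists dl => // u /andP[u0 uT] ut; apply: H.
  by rewrite lerBrDr addNr u0 subr_le0 (le_trans uT).
by rewrite opprB addrA subrK.
Qed.

Definition solution_drift t w : 'cV[R]_d :=
  \col_(i < d) (\int[mu]_(s in `[0, t]) (f (x s w) (x (s - tau) w) i 0)).

Lemma measurable_solution_drift t : t <= tau -> mxmeas (solution_drift t).
Proof.
move=> tt i j; pose h s w := f (x s w) (x (s - tau) w) i 0.
rewrite (_ : (fun w => _) = (fun w => \int[mu]_(s in `[0, t]) h s w)).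
  apply: measurable_time_Rintegral; apply: (measurable_caratheodory (h := h)).
    move=> s /andP[s0 st].
    rewrite /h; under eq_fun do rewrite solution_delay ?s0 ?(le_trans st)//.
    exact: (measurable_locally_lipschitz lip_f (xi (s - tau))
      (solution_mxmeas s0) i 0).
  move=> w; apply: (path_continuous_locally_lipschitz lip_f).
    by apply: solution_path_continuous; rewrite oppr_le0 ltW.
  exact: delay_continuous.
by apply/funext => w; rewrite mxE.
Qed.

Lemma solution_drift_bound t w (K : R) : 0 <= K -> 0 <= t ->
  (forall i, mu.-integrable `[0, t]
     (fun s => (f (x s w) (x (s - tau) w) i 0)%:E)) ->
  (forall s, 0 <= s <= t -> enorm (f (x s w) (x (s - tau) w)) <= K) ->
  enorm (solution_drift t w) <= d%:R * (K * t).
Proof.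
move=> K0 t0 fint fK.
have -> : d%:R * (K * t) = (d * 1)%:R * (K * t) by rewrite muln1.
apply: enorm_mx_norm => [|i j]; first exact: mulr_ge0.
rewrite mxE -lee_fin EFin_normr_Rintegral//; last exact: fint.
have mf := measurable_int _ (fint i).
apply: le_trans (le_abse_integral _ _ mf) _ => //.
have fK' : {ae mu, forall s, `[0, t]%classic s ->
    (`|(f (x s w) (x (s - tau) w) i 0)%:E| <= K%:E)%E}.
  apply: aeW => s /=; rewrite in_itv/= => /fK; rewrite lee_fin; apply: le_trans.
  exact: le_coord_enorm.
have K0' : (0 <= K%:E)%E by rewrite lee_fin.
apply: le_trans (integral_le_bound K%:E _ mf K0' fK') _ => //.
rewrite [X in (_ * X <= _)%E]lebesgue_measure_itv/= lte_fin EFinM.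
apply: lee_wpmul2l; first by rewrite lee_fin.
by case: ifPn; rewrite ?sube0 ?lee_fin.
Qed.

End OneSolution.

(** Started in a fixed ball, the solution stays close to its initial value for
    a time that depends on the ball only.  Until it first leaves the
    eps-neighbourhood of the initial value all coefficients are bounded by
    constants, so its drift is small outright and its martingale part is small
    with high probability; hence it has no way to leave. *)
Lemma solution_stays (r eps eta : R) : 0 < r -> 0 < eps -> 0 < eta ->
  exists delta : R, [/\ 0 < delta, delta <= tau &
    forall xi, sup_ball tau r xi ->
    forall x, sdde_solution P F W tau f g xi x ->
    exists E : set Om, [/\ measurable E, (P E <= eta%:E)%E &
      forall w, ~ E w -> forall t, 0 <= t <= delta ->
        enorm (x t w - xi 0) <= eps]].
Proof.
move=> r0 eps0 eta0.
have rho0 : 0 <= r + eps by rewrite addr_ge0// ltW.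
have [Kf Kf0 HKf] := locally_lipschitz_bounded lip_f rho0.
have [Kg Kg0 HKg] := locally_lipschitz_bounded lip_g rho0.
pose K := Kg ^+ 2; have K0 : 0 <= K by exact: sqr_ge0.
pose a := eps / 4; have a0 : 0 < a by rewrite divr_gt0.
have a20 : 0 < a ^+ 2 by rewrite exprn_gt0.
pose A := 64 * m%:R * (K + 1) / a ^+ 2.
have A0 : 0 <= A by rewrite divr_ge0 ?(ltW a20)// !mulr_ge0// addr_ge0.
pose B := d%:R * Kf; have B0 : 0 <= B by rewrite mulr_ge0.
have A1 : 0 < A + 1 by rewrite ltr_wpDl.
have B1 : 0 < B + 1 by rewrite ltr_wpDl.
pose delta := Num.min tau (Num.min (a / (B + 1)) (eta / 2 / (A + 1))).
have delta0 : 0 < delta by rewrite !lt_min tau0 !divr_gt0.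
have delta_tau : delta <= tau by rewrite ge_min lexx.
have delta_B : B * delta <= a.
  have h : delta <= a / (B + 1) by rewrite /delta !ge_min lexx orbT.
  apply: le_trans (_ : (B + 1) * delta <= _).
    by rewrite ler_wpM2r ?(ltW delta0)// lerDl.
  by rewrite mulrC -ler_pdivlMr.
have delta_A : A * delta <= eta / 2.
  have h : delta <= eta / 2 / (A + 1) by rewrite /delta !ge_min lexx !orbT.
  apply: le_trans (_ : (A + 1) * delta <= _).
    by rewrite ler_wpM2r ?(ltW delta0)// lerDl.
  by rewrite mulrC -ler_pdivlMr.
exists delta; split => // xi xi_r x sol.
have [I [itoI solI]] := sol_eq sol.
have xi0 : enorm (xi 0) <= r.
  by apply: (sup_ball_bound xi_r); rewrite lexx oppr_le0 ltW.
pose N1 := [set w | ~ forall t, 0 <= t ->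
  x t w = xi 0 + solution_drift x t w + I t w].
have NN1 : P.-negligible N1 by exact: solI.
pose N2 := [set w | ~ forall (T : R) (i : 'I_d), 0 <= T ->
  mu.-integrable `[0, T] (fun s => (f (x s w) (x (s - tau) w) i 0)%:E)].
have NN2 : P.-negligible N2 by exact: (sol_drift_int sol).
have IE t w : ~ N1 w -> 0 <= t -> I t w = x t w - xi 0 - solution_drift x t w.
  move=> /contrapT H t0; rewrite (H t t0).
  by rewrite -[RHS]addrA -opprD [RHS]addrC addKr.
have mI t : 0 <= t <= delta -> mxmeas (I t).
  move=> /andP[t0 td] i j _ C mC; rewrite setTI.
  have mJ : mxmeas (fun w => x t w - xi 0 - solution_drift x t w).
    apply: mxmeasB; last first.
      by apply: (measurable_solution_drift sol); exact: le_trans delta_tau.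
    by apply: mxmeasB; [exact: (solution_mxmeas sol)|exact: mxmeas_cst].
  have := mJ i j measurableT C mC; rewrite setTI.
  move/(measurable_ae_eq filtF NN1); apply => w Nw /=.
  by rewrite IE.
have eta20 : 0 < eta / 2 by rewrite divr_gt0.
have [E [mE PE HE]] := ito_maximal_inequality filtF bmW itoI delta0 a0 K0 eta20 mI.
have mN1 := negligible_measurable filtF NN1.
have mN2 := negligible_measurable filtF NN2.
have mEN := measurableU _ _ mE mN1.
exists (E `|` N1 `|` N2); split; first exact: measurableU.
  apply: le_trans (measureU2 _ mEN mN2) _.
  rewrite [X in (_ + X)%E](measure_negligible mN2 NN2) adde0.
  apply: le_trans (measureU2 _ mE mN1) _.
  rewrite [X in (_ + X)%E](measure_negligible mN1 NN1) adde0.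
  apply: le_trans PE _; rewrite lee_fin [leRHS](splitr eta) lerD2r.
  apply: le_trans delta_A; rewrite /A le_eqVlt; apply/orP; left.
  by apply/eqP; field; rewrite gt_eqF.
move=> w nE t /andP[t0 td].
have [nEw nN1 nN2] : [/\ ~ E w, ~ N1 w & ~ N2 w].
  by split => h; apply: nE; do ?[by right|left].
rewrite leNgt; apply/negP => exc.
have cphi : path_continuous 0 t (fun s => enorm (x s w - xi 0)).
  move=> s e st e0.
  have [|dl dl0 H] := solution_path_continuous sol (a := 0) (b := t) w _ st e0.
    by rewrite oppr_le0 ltW.
  exists dl => // u ut us; apply: le_lt_trans (ler_enorm_dist _ _) _.
  have -> : x u w - xi 0 - (x s w - xi 0) = x u w - x s w.
    by rewrite opprB addrA subrK.
  exact: H.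
have phi0 : enorm (x 0 w - xi 0) < eps.
  by rewrite (sol_initial sol) ?lexx ?oppr_le0 ?(ltW tau0)// subrr enorm0.
have [t1 [/andP[t10 t1t] phit1 stay]] := path_continuous_hitting cphi t0 phi0 exc.
have t1d : t1 <= delta by exact: le_trans td.
have t1tau : t1 <= tau by exact: le_trans delta_tau.
have xs s : 0 <= s <= t1 -> enorm (x s w) <= r + eps.
  move=> st; have := enormD (xi 0) (x s w - xi 0); rewrite addrC subrK.
  by move=> /le_trans; apply; apply: lerD => //; exact: stay.
have xd s : 0 <= s <= t1 -> enorm (x (s - tau) w) <= r + eps.
  move=> /andP[s0 st]; rewrite (solution_delay sol); last first.
    by rewrite s0 (le_trans st).
  apply: (@le_trans _ _ r); last by rewrite lerDl ltW.
  by apply: (sup_ball_bound xi_r); rewrite lerBrDr addNr s0 subr_le0 (le_trans st).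
have It1 : enorm (I t1 w) <= a.
  apply: (HE w nEw); first by rewrite t10.
  move=> u ut1; rewrite /K ler_sqr ?nnegrE ?enorm_ge0//.
  by apply: HKg; [exact: xs|exact: xd].
have Dt1 : enorm (solution_drift x t1 w) <= a.
  apply: le_trans (solution_drift_bound Kf0 t10 _ _) _.
  - by move/contrapT : nN2 => fint i; exact: fint.
  - by move=> s st; apply: HKf; [exact: xs|exact: xd].
  - by rewrite mulrA; apply: le_trans delta_B; rewrite ler_wpM2l.
have := enormD (solution_drift x t1 w) (I t1 w).
have -> : solution_drift x t1 w + I t1 w = x t1 w - xi 0.
  by rewrite (IE t1 w nN1 t10) addrC subrK.
rewrite phit1 => h.
have : eps <= a + a by apply: le_trans h _; exact: lerD.
by rewrite /a; lra.
Qed.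

End SmallTimeSolution.

(** * The backward Euler scheme over finitely many steps *)

Section ImplicitStep.
Variables (R : realType) (d : nat).
Variable phi : 'cV[R]_d -> 'cV[R]_d.
Hypothesis phi_mono : forall u v, inner (u - v) (phi u - phi v) <= 0.

(** The implicit step inverts u - D phi(u); monotonicity makes that inverse
    nonexpansive. *)
Lemma implicit_step_nonexpansive (D : R) u v : 0 <= D ->
  enorm (u - v) <= enorm ((u - D *: phi u) - (v - D *: phi v)).
Proof.
move=> D0; set z := (_ - _ - _).
have zE : z = (u - v) + (- D) *: (phi u - phi v).
  by rewrite /z scaleNr scalerBr !opprD !opprK addrACA.
have h : enorm (u - v) ^+ 2 <= enorm (u - v) * enorm z.
  apply: le_trans (inner_le _ _); rewrite zE innerDr innerZr inner_enorm lerDl.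
  by rewrite mulNr oppr_ge0 mulr_ge0_le0.
have [uv0|uv_gt0] := leP (enorm (u - v)) 0.
  exact: le_trans uv0 (enorm_ge0 _).
by move: h; rewrite expr2 ler_pM2l.
Qed.

End ImplicitStep.

Section BackwardEuler.
Context (R : realType) dO (Om : measurableType dO) (P : probability Om R).
Variable F : R -> set (set Om).
Variables (m d : nat) (W : R -> Om -> 'cV[R]_m) (tau : R).
Variables (f : 'cV[R]_d -> 'cV[R]_d -> 'cV[R]_d).
Variables (g : 'cV[R]_d -> 'cV[R]_d -> 'M[R]_(d, m)).
Hypothesis filtF : usual_filtration P F.
Hypothesis bmW : brownian_motion P F W.
Hypothesis tau0 : 0 < tau.
Hypothesis lip_f : locally_lipschitz f.
Hypothesis lip_g : locally_lipschitz g.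
Hypothesis mono_f : forall u v y, inner (u - v) (f u y - f v y) <= 0.

(** Each increment is a one-step stochastic integral of the unit matrix, so the
    discrete maximal inequality applies to it. *)
Lemma bm_increments_small (k : nat) (D rho : R) : 0 <= D -> 0 < rho ->
  exists E : set Om,
  [/\ measurable E,
      (P E <= (k%:R * (8 * m%:R * (enorm (1%:M : 'M[R]_m) ^+ 2 * D)
         / rho ^+ 2))%:E)%E &
   forall w, ~ E w -> forall j, (j < k)%N ->
     enorm (W (j.+1%:R * D) w - W (j%:R * D) w) <= rho].
Proof.
move=> D0 rho0; elim: k => [|k [E [mE PE HE]]].
  by exists set0; split=> //; rewrite measure0 mul0r.
have c0 : 0 <= enorm (1%:M : 'M[R]_m) ^+ 2 * D by rewrite mulr_ge0 ?sqr_ge0.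
have [] := @disc_maximal_inequality R dO Om P F m W filtF bmW m 1
  (fun i => (k + i)%:R * D) (fun _ _ => 1%:M) rho
  (enorm (1%:M : 'M[R]_m) ^+ 2 * D) (enorm (1%:M : 'M[R]_m)) => //.
- by rewrite mulr_ge0.
- by move=> i _; rewrite ler_wpM2r// ler_nat addnS.
- by move=> i _; exact: mxmeas_cst.
move=> E' [mE' PE' HE'].
exists (E `|` E'); split; first exact: measurableU.
  apply: le_trans (measureU2 _ mE mE') _.
  by rewrite -natr1 mulrDl mul1r EFinD; apply: leeD.
move=> w nE j; rewrite ltnS leq_eqVlt => /orP[/eqP->|jk]; last first.
  by apply: (HE w) => // Ew; apply: nE; left.
rewrite leNgt; apply/negP => h; apply: nE; right; apply: (HE' 1%N w) => //.
  rewrite /disc_bracket big_ord1 addn0 addn1 -mulrBl.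
  by rewrite -natrB// subSnn mul1r.
by rewrite /disc_int big_ord1 addn0 addn1 mul1mx ltW.
Qed.

Section OneScheme.
Variables (r : R) (xi : R -> 'cV[R]_d) (M : nat) (X : int -> Om -> 'cV[R]_d).
Hypothesis xi_r : sup_ball tau r xi.
Hypothesis M0 : (0 < M)%N.
Hypothesis bemX : bem_scheme W tau f g xi M X.
Local Notation D := (tau / M%:R).

Let D_gt0 : 0 < D. Proof. by rewrite divr_gt0// ltr0n. Qed.

Lemma bem_start w : X 0 w = xi 0.
Proof. by rewrite (bem_initial bemX) ?mul0r// lexx andbT oppr_le0. Qed.

(** The delayed values used by the first M steps are those of the initial
    path. *)
Let delayed (j : nat) : 'cV[R]_d := xi ((j%:Z - M%:Z)%:~R * D).

Let delayedE j w : (j <= M)%N -> X (j%:Z - M%:Z) w = delayed j.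
Proof.
move=> jM; apply: (bem_initial bemX).
by rewrite subr_le0 lez_nat jM andbT -[leLHS]add0r lerD2r.
Qed.

Let delayed_bound j : (j <= M)%N -> enorm (delayed j) <= r.
Proof.
move=> jM; apply: (sup_ball_bound xi_r).
have jM' : j%:R <= M%:R :> R by rewrite ler_nat.
have tE : tau = M%:R * D by rewrite mulrC divfK// pnatr_eq0 -lt0n.
rewrite rmorphB/= -!pmulrn [X in - X <= _]tE -mulNr ler_pM2r// pmulr_lle0//.
by rewrite subr_le0 jM' andbT -[leLHS]add0r lerD2r.
Qed.

Lemma bem_succ j w : (j < M)%N ->
  X j.+1%:Z w = X j%:Z w + D *: f (X j.+1%:Z w) (delayed j.+1)
    + g (X j%:Z w) (delayed j) *m (W (j.+1%:R * D) w - W (j%:R * D) w).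
Proof.
move=> jM; have := bem_step bemX w (isT : 1 <= j.+1%:Z) => /=.
have E1 : j.+1%:Z - 1 = j%:Z by rewrite -addn1 PoszD addrK.
rewrite E1 [j.+1%:Z - M%:Z - 1]addrAC E1.
by rewrite (delayedE w jM) (delayedE w (ltnW jM)) -!pmulrn.
Qed.

Let noise j w := g (X j%:Z w) (delayed j) *m
  (W (j.+1%:R * D) w - W (j%:R * D) w).

(** The outcome X_(j + 1) depends on the explicit part of the step through a
    nonexpansive map. *)
Lemma bem_mxmeas j : (j <= M)%N -> mxmeas (X j%:Z).
Proof.
elim: j => [_|j IH jM].
  rewrite (_ : X _ = fun=> xi 0); first exact: mxmeas_cst.
  by apply/funext => w; exact: bem_start.
have mX := IH (ltnW jM).
pose Z w := X j%:Z w + noise j w.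
have mZ : mxmeas Z.
  apply: mxmeasD => //; apply: mxmeasM.
    exact: (measurable_locally_lipschitz lip_g).
  by apply: mxmeasB; apply: (bm_mxmeas filtF bmW); rewrite mulr_ge0// ltW.
have ZE w : X j.+1%:Z w - D *: f (X j.+1%:Z w) (delayed j.+1) = Z w.
  by rewrite {1}bem_succ// /Z /noise addrAC addrK.
move=> i l; apply: (measurable_continuous_factor mZ) => w e e0.
exists e => // w' ww'.
have := le_coord_enorm (X j.+1%:Z w' - X j.+1%:Z w) i l; rewrite !mxE.
move=> /le_lt_trans; apply; apply: le_lt_trans ww'; rewrite -!ZE.
apply: (implicit_step_nonexpansive (phi := fun u => f u (delayed j.+1))) => //.
exact: ltW.
Qed.

(** Compare X_(j + 1) with X_j through the nonexpansive inverse of the implicit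
    step, so that f is evaluated at X_j rather than at the unknown X_(j + 1). *)
Lemma bem_step_bound j w : (j < M)%N ->
  enorm (X j.+1%:Z w - X j%:Z w) <=
  D * enorm (f (X j%:Z w) (delayed j.+1)) +
  enorm (g (X j%:Z w) (delayed j)) *
    enorm (W (j.+1%:R * D) w - W (j%:R * D) w).
Proof.
move=> jM.
apply: le_trans (implicit_step_nonexpansive
  (phi := fun u => f u (delayed j.+1)) (fun u v => mono_f u v _)
  _ _ (ltW D_gt0)) _.
have -> : X j.+1%:Z w - D *: f (X j.+1%:Z w) (delayed j.+1) -
    (X j%:Z w - D *: f (X j%:Z w) (delayed j.+1)) =
    D *: f (X j%:Z w) (delayed j.+1) + noise j w.
  rewrite {1}bem_succ// -/(noise j w) [_ + noise j w]addrAC addrK opprB.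
  by rewrite addrCA addrAC subrr add0r.
apply: le_trans (enormD _ _) _; apply: lerD.
  by rewrite enormZ gtr0_norm.
exact: enorm_mulmx.
Qed.

Lemma bem_stays (eps Kf Kg rho : R) (k : nat) w : 0 <= r -> 0 <= eps ->
  0 <= Kf -> 0 <= Kg -> 0 <= rho -> (k <= M)%N ->
  (forall u v, enorm u <= r + eps -> enorm v <= r + eps ->
     enorm (f u v) <= Kf) ->
  (forall u v, enorm u <= r + eps -> enorm v <= r + eps ->
     enorm (g u v) <= Kg) ->
  k%:R * (D * Kf + Kg * rho) <= eps ->
  (forall j, (j < k)%N -> enorm (W (j.+1%:R * D) w - W (j%:R * D) w) <= rho) ->
  forall j, (j <= k)%N -> enorm (X j%:Z w - xi 0) <= eps.
Proof.
move=> r0 eps0 Kf0 Kg0 rho0 kM HKf HKg keps Hdw.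
set b := D * Kf + Kg * rho in keps.
have b0 : 0 <= b by rewrite addr_ge0// mulr_ge0// ltW.
suff H j : (j <= k)%N -> enorm (X j%:Z w - xi 0) <= j%:R * b.
  move=> j jk; apply: le_trans (H j jk) _; apply: le_trans keps.
  by rewrite ler_wpM2r// ler_nat.
elim: j => [_|j IH jk]; first by rewrite bem_start subrr enorm0 mul0r.
have jM : (j < M)%N by exact: leq_trans jk kM.
have Xj := IH (ltnW jk).
have xi0 : enorm (xi 0) <= r.
  by apply: (sup_ball_bound xi_r); rewrite lexx oppr_le0 ltW.
have Xr : enorm (X j%:Z w) <= r + eps.
  have := enormD (X j%:Z w - xi 0) (xi 0); rewrite subrK addrC.
  move=> /le_trans; apply; apply: lerD => //; apply: le_trans Xj _.
  by apply: le_trans keps; rewrite ler_wpM2r// ler_nat ltnW.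
have dr i : (i <= M)%N -> enorm (delayed i) <= r + eps.
  by move=> iM; apply: le_trans (delayed_bound iM) _; rewrite lerDl.
apply: le_trans (enorm_le_trans _ (X j%:Z w) _) _.
rewrite -natr1 mulrDl mul1r addrC; apply: lerD => //.
apply: le_trans (bem_step_bound w jM) _; apply: lerD.
  by rewrite ler_wpM2l ?(ltW D_gt0)//; apply: HKf => //; exact: dr.
apply: ler_pM; rewrite ?enorm_ge0//; last exact: Hdw.
by apply: HKg => //; apply: dr; exact: ltnW.
Qed.

Definition bem_affine (j : nat) (t : R) (w : Om) : 'cV[R]_d :=
  X j%:Z w + (t / D - j%:R) *: (X j.+1%:Z w - X j%:Z w).

(** The right end point may be included because consecutive affine pieces agree
    there. *)
Lemma bem_interpE j t w : j%:R * D <= t <= j.+1%:R * D ->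
  bem_interp tau xi M X t w = bem_affine j t w.
Proof.
move=> /andP[jt tj]; rewrite /bem_interp /bem_affine.
have [t0|t0] := leP t 0.
  have j0 : j = 0%N.
    have : j%:R * D <= 0 by exact: le_trans t0.
    by rewrite pmulr_lle0// lern0 => /eqP.
  have -> : t = 0.
    by apply/eqP; rewrite eq_le t0; move: jt; rewrite j0 mul0r.
  by rewrite j0 mul0r subr0 scale0r addr0 bem_start.
have x1 : j%:R <= t / D by rewrite ler_pdivlMr.
have : t / D <= j.+1%:R by rewrite ler_pdivrMr.
rewrite le_eqVlt => /orP[/eqP x2|x2].
  have -> : Num.floor (t / D) = j.+1%:Z.
    by apply: floor_def; rewrite x2 -PoszD addn1 -!pmulrn lexx ltr_nat /=.
  rewrite x2 -pmulrn subrr scale0r addr0 -natr1 addrAC subrr add0r scale1r.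
  by rewrite addrC subrK.
have -> : Num.floor (t / D) = j%:Z.
  by apply: floor_def; rewrite -PoszD addn1 -!pmulrn x1.
by rewrite -pmulrn -PoszD addn1.
Qed.

Lemma bem_affine_continuous j a b w : mx_path_continuous a b (bem_affine j ^~ w).
Proof.
move=> t e _ e0; set V := X j.+1%:Z w - X j%:Z w.
have V1 : 0 < enorm V + 1 by rewrite ltr_wpDl ?enorm_ge0.
exists (e * D / (enorm V + 1)); first by rewrite divr_gt0// mulr_gt0.
move=> u _ ut; rewrite /bem_affine -/V opprD addrACA subrr add0r -scalerBl.
rewrite opprB addrA subrK -mulrBl enormZ normrM [`|D^-1|]gtr0_norm ?invr_gt0//.
apply: (@le_lt_trans _ _ (`|u - t| / D * (enorm V + 1))).
  by rewrite ler_wpM2l ?lerDl// mulr_ge0// invr_ge0 ltW.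
by rewrite mulrAC ltr_pdivrMr// -ltr_pdivlMr.
Qed.

Lemma bem_affine_bound j t w (eps : R) : j%:R * D <= t <= j.+1%:R * D ->
  enorm (X j%:Z w - xi 0) <= eps -> enorm (X j.+1%:Z w - xi 0) <= eps ->
  enorm (bem_affine j t w - xi 0) <= eps.
Proof.
move=> /andP[jt tj] h1 h2; rewrite /bem_affine.
set th := t / D - j%:R.
have th0 : 0 <= th by rewrite subr_ge0 ler_pdivlMr.
have th1 : th <= 1 by rewrite lerBlDr addrC natr1 ler_pdivrMr.
have -> : X j%:Z w + th *: (X j.+1%:Z w - X j%:Z w) - xi 0 =
    (1 - th) *: (X j%:Z w - xi 0) + th *: (X j.+1%:Z w - xi 0).
  by apply/matrixP => i l; rewrite !mxE; ring.
apply: le_trans (enormD _ _) _.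
rewrite !enormZ ger0_norm ?subr_ge0// ger0_norm//.
have -> : eps = (1 - th) * eps + th * eps by ring.
by apply: lerD; apply: ler_wpM2l => //; rewrite subr_ge0.
Qed.

End OneScheme.

End BackwardEuler.

(** * Consequences of the structural conditions *)

Section StructuralConditions.
Variables (R : realType) (d m : nat).
Variables (f : 'cV[R]_d -> 'cV[R]_d -> 'cV[R]_d).
Variables (g : 'cV[R]_d -> 'cV[R]_d -> 'M[R]_(d, m)).
Variables (q a1 a2 a3 a4 a5 a6 a7 a8 a9 e1 e2 : R).
Variables (g1 g2 : 'cV[R]_d -> 'M[R]_(d, m)).
Hypothesis reg : regularity f g q a1 a2 a3 a4 a5 a6 a7 a8 a9 e1 e2 g1 g2.

Let pow_le (rho : R) (x : 'cV[R]_d) :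
  enorm x <= rho -> enorm x `^ (q - 1) <= rho `^ (q - 1).
Proof.
move=> xr; apply: ge0_ler_powR => //; rewrite ?nnegrE ?enorm_ge0//.
  by have := reg_q reg; lra.
exact: le_trans (enorm_ge0 x) xr.
Qed.

Lemma regularity_lipschitz_f : locally_lipschitz f.
Proof.
move=> rho; have [[a10 _ _] _ _] := reg_a_ge0 reg.
set p := rho `^ (q - 1); have p0 : 0 <= p by exact: powR_ge0.
exists (a1 * (1 + p + p + p + p)); first by rewrite mulr_ge0// !addr_ge0.
move=> x x' y y' xr x'r yr y'r; apply: le_trans (reg_f reg x x' y y') _.
apply: ler_wpM2r; first by rewrite addr_ge0 ?enorm_ge0.
by apply: ler_wpM2l => //; do !(apply: lerD => //; try exact: pow_le).
Qed.

(** The Lipschitz constant is the square root of the one that the condition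
    gives for the squares. *)
Lemma regularity_lipschitz_g : locally_lipschitz g.
Proof.
move=> rho; have [[_ a20 a30] [a40 a50 _] _] := reg_a_ge0 reg.
set p := rho `^ (q - 1); have p0 : 0 <= p by exact: powR_ge0.
pose L := a2 + a3 + (a4 + a5) * (p + p).
have L0 : 0 <= L by rewrite !addr_ge0// mulr_ge0// addr_ge0.
exists (Num.sqrt L) => [|x x' y y' xr x'r yr y'r]; first exact: sqrtr_ge0.
have u0 := enorm_ge0 (x - x'); have v0 := enorm_ge0 (y - y').
rewrite enorm_le; last by rewrite mulr_ge0 ?sqrtr_ge0// addr_ge0.
rewrite exprMn [Num.sqrt L ^+ 2]sqr_sqrtr//.
have V1 : Vfun q x x' <= enorm (x - x') ^+ 2 * (p + p).
  by rewrite ler_wpM2l ?sqr_ge0// lerD// pow_le.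
have V2 : Vfun q y y' <= enorm (y - y') ^+ 2 * (p + p).
  by rewrite ler_wpM2l ?sqr_ge0// lerD// pow_le.
have h := reg_g reg x x' y y'; have h1 := reg_g1 reg x x'.
have h2 := reg_g2 reg y y'.
have k1 := ler_wpM2l a40 V1; have k2 := ler_wpM2l a50 V2.
apply: le_trans h _; apply: le_trans (lerD h1 h2) _.
apply: le_trans (lerD (lerD (lexx _) k1) (lerD (lexx _) k2)) _.
rewrite /L; move: (enorm (x - x')) (enorm (y - y')) u0 v0 => u v u0 v0.
have pp0 : 0 <= p + p by rewrite addr_ge0.
move: (p + p) pp0 => s s0.
have -> : (a2 + a3 + (a4 + a5) * s) * (u + v) ^+ 2 =
   (a2 * u ^+ 2 + a4 * (u ^+ 2 * s) + (a3 * v ^+ 2 + a5 * (v ^+ 2 * s))) +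
   (a2 * (2 * u * v + v ^+ 2) + a3 * (2 * u * v + u ^+ 2) +
    a4 * s * (2 * u * v + v ^+ 2) + a5 * s * (2 * u * v + u ^+ 2)) by ring.
rewrite lerDl; have w0 : 0 <= 2 * u * v by rewrite !mulr_ge0.
by rewrite !addr_ge0// mulr_ge0// ?addr_ge0// ?sqr_ge0// mulr_ge0.
Qed.

Variables (b1 b2 b3 b4 b5 b6 b7 b8 b9 b10 b11 b12 b13 l1 l2 : R).
Hypothesis dis : dissipativity f g q a2 a3 a4 a5
  b1 b2 b3 b4 b5 b6 b7 b8 b9 b10 b11 b12 b13 l1 l2.

Lemma dissipativity_monotone u v y : inner (u - v) (f u y - f v y) <= 0.
Proof.
have [[b1_ge0 _ b3_ge0 _] _ _ _] := dis_b_ge0 dis.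
have := dis_f dis u v y y; rewrite subrr enorm0 expr0n/= mulr0 addr0 => h.
rewrite -(pmulr_rle0 _ (ltr0Sn R 1)); apply: le_trans h _.
rewrite mulNr -opprD oppr_le0 addr_ge0// mulr_ge0// ?sqr_ge0//.
by rewrite /Vfun mulr_ge0 ?sqr_ge0// addr_ge0// powR_ge0.
Qed.

End StructuralConditions.

(** * Convergence in probability of the numerical segment *)

Theorem lemma4p7 (R : realType) (d m : nat)
    (dO : measure_display) (Om : measurableType dO) (P : probability Om R)
    (F : R -> set (set Om)) (W : R -> Om -> 'cV[R]_m) (tau : R)
    (f : 'cV[R]_d -> 'cV[R]_d -> 'cV[R]_d)
    (g : 'cV[R]_d -> 'cV[R]_d -> 'M[R]_(d, m))
    (q a1 a2 a3 a4 a5 a6 a7 a8 a9 e1 e2 : R)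
    (g1 g2 : 'cV[R]_d -> 'M[R]_(d, m))
    (b1 b2 b3 b4 b5 b6 b7 b8 b9 b10 b11 b12 b13 l1 l2 : R) (r : R) :
  0 < tau ->
  usual_filtration P F ->
  brownian_motion P F W ->
  borel_measurable (fun xy : 'cV[R]_d * 'cV[R]_d => f xy.1 xy.2) ->
  borel_measurable (fun xy : 'cV[R]_d * 'cV[R]_d => g xy.1 xy.2) ->
  regularity f g q a1 a2 a3 a4 a5 a6 a7 a8 a9 e1 e2 g1 g2 ->
  dissipativity f g q a2 a3 a4 a5
    b1 b2 b3 b4 b5 b6 b7 b8 b9 b10 b11 b12 b13 l1 l2 ->
  0 < r ->
  forall (eps10 eps11 : R) (k : nat), 0 < eps10 -> 0 < eps11 ->
  exists Delta4 : R, 0 < Delta4 /\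
    forall M : nat, (0 < M)%N ->
    let Delta := tau / M%:R in
    let tk := k%:R * Delta in
    Delta <= Delta4 ->
    forall xi : R -> 'cV[R]_d, sup_ball tau r xi ->
    forall x : R -> Om -> 'cV[R]_d, sdde_solution P F W tau f g xi x ->
    forall X : int -> Om -> 'cV[R]_d, bem_scheme W tau f g xi M X ->
    (P [set w | (eps10%:E <
         sup_norm tau (segment (bem_interp tau xi M X ^~ w) tk
                        \- segment (x ^~ w) tk)%R)%E]
       < eps11%:E)%E.
Proof.
move=> tau0 filtF bmW _ _ reg dis r0 eps10 eps11 k eps10_gt0 eps11_gt0.
have lip_f := regularity_lipschitz_f reg.
have lip_g := regularity_lipschitz_g reg.
have mono_f := dissipativity_monotone dis.
pose eps := eps10 / 2; have eps0 : 0 < eps by rewrite divr_gt0.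
pose eta := eps11 / 4; have eta0 : 0 < eta by rewrite divr_gt0.
have [delta [delta0 delta_tau Hsol]] :=
  solution_stays filtF bmW tau0 lip_f lip_g r0 eps0 eta0.
have rho0 : 0 <= r + eps by rewrite addr_ge0// ltW.
have [Kf Kf0 HKf] := locally_lipschitz_bounded lip_f rho0.
have [Kg Kg0 HKg] := locally_lipschitz_bounded lip_g rho0.
pose c := 2 * (k%:R * Kf + 1).
have c0 : 0 < c by rewrite mulr_gt0// ltr_wpDl// mulr_ge0.
pose c' := 2 * (k%:R * Kg + 1).
have c'0 : 0 < c' by rewrite mulr_gt0// ltr_wpDl// mulr_ge0.
pose rho := eps / c'; have rho_gt0 : 0 < rho by rewrite divr_gt0.
pose b := k%:R * (8 * m%:R * enorm (1%:M : 'M[R]_m) ^+ 2 / rho ^+ 2).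
have b0 : 0 <= b.
  by rewrite mulr_ge0// divr_ge0 ?sqr_ge0// mulr_ge0 ?sqr_ge0// mulr_ge0.
have b1_gt0 : 0 < b + 1 by rewrite ltr_wpDl.
have k1 : 0 < k.+1%:R :> R by rewrite ltr0n.
exists (Num.min (delta / k.+1%:R) (Num.min (eps / c) (eta / (b + 1)))).
split; first by rewrite !lt_min !divr_gt0.
move=> M M0 D tk; rewrite !le_min => /and3P[D1 D2 D3] xi xi_r x sol X bemX.
have D_gt0 : 0 < D by rewrite divr_gt0// ltr0n.
have tk0 : 0 <= tk by rewrite mulr_ge0// ltW.
have tk_delta : tk <= delta.
  move: D1; rewrite ler_pdivlMr// mulrC; apply: le_trans.
  by rewrite ler_wpM2r ?(ltW D_gt0)// ler_nat.
have tk_tau : tk <= tau by exact: le_trans delta_tau.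
have tauE : tau = M%:R * D by rewrite mulrC divfK// pnatr_eq0 -lt0n.
have kM : (k <= M)%N by move: tk_tau; rewrite /tk tauE ler_pM2r// ler_nat.
have [Ex [mEx PEx HEx]] := Hsol xi xi_r x sol.
have [Ew [mEw PEw HEw]] := bm_increments_small filtF bmW k (ltW D_gt0) rho_gt0.
(* Splitting the time interval at the grid points makes both paths continuous
   on each piece, which gives the measurability of the event. *)
pose Y j t w := bem_affine tau M X j t w - x t w.
pose B j := [set w | exists2 t, j%:R * D <= t <= j.+1%:R * D &
                     eps10 < enorm (Y j t w)].
have step_le j : j%:R * D <= j.+1%:R * D.
  by rewrite ler_wpM2r ?(ltW D_gt0)// ler_nat.
have negl0 : P.-negligible (set0 : set Om) by exact: negligible_set0.
have mB j : (j < k)%N -> measurable (B j).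
  move=> jk; have jM : (j < M)%N by exact: leq_trans jk kM.
  apply: (measurable_exceed eps10 filtF negl0 (step_le j)).
    move=> t /andP[jt _]; have t0 : 0 <= t.
      by apply: le_trans jt; rewrite mulr_ge0// ltW.
    have mXl := bem_mxmeas filtF bmW tau0 lip_g mono_f M0 bemX (ltnW jM).
    have mXr := bem_mxmeas filtF bmW tau0 lip_g mono_f M0 bemX jM.
    apply: mxmeasB; last exact: (solution_mxmeas filtF sol).
    apply: mxmeasD => //; apply: mxmeasZ; first exact: measurable_cst.
    exact: mxmeasB.
  move=> w _; apply: mx_path_continuousB; first exact: bem_affine_continuous.
  apply: (solution_path_continuous sol).
  by rewrite (@le_trans _ _ 0)// ?oppr_le0 ?(ltW tau0)// mulr_ge0// ltW.
set G := [set w | _].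
have GB : G `<=` \bigcup_(j in `I_k) B j.
  move=> w /sup_enorm_gtE[th]; rewrite /= in_itv/= /segment => /andP[th1 th2] exc.
  have [t_le0|t_gt0] := leP (tk + th) 0.
    exfalso; move: exc; rewrite /bem_interp t_le0 (sol_initial sol).
      by rewrite subrr enorm0 ltNge ltW.
    by rewrite t_le0 andbT -[leLHS]add0r lerD.
  have [j jk /andP[jt tj]] : exists2 j, (j < k)%N &
      j%:R * D <= tk + th <= j.+1%:R * D.
    have : tk + th <= k%:R * D by rewrite gerDl.
    elim: (k) => [|l IH]; first by rewrite mul0r leNgt t_gt0.
    have [tl _|lt tl] := leP (tk + th) (l%:R * D).
      by have [j jl jt] := IH tl; exists j => //; exact: ltnW.
    by exists l => //; rewrite tl ltW.
  exists j => //=; exists (tk + th); first by rewrite jt.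
  by rewrite /Y -(bem_interpE tau0 M0 bemX) ?jt.
have BG : \bigcup_(j in `I_k) B j `<=` G.
  move=> w [j /= jk [t /andP[jt tj]]].
  rewrite /Y -(bem_interpE tau0 M0 bemX) ?jt// => exc.
  apply/sup_enorm_gtE; exists (t - tk).
    rewrite /= in_itv/=; apply/andP; split.
      rewrite lerBrDr; apply: (@le_trans _ _ 0).
        by rewrite addrC subr_le0.
      by apply: le_trans jt; rewrite mulr_ge0// ltW.
    rewrite subr_le0; apply: le_trans tj _.
    by rewrite ler_wpM2r ?(ltW D_gt0)// ler_nat.
  have tE : tk + (t - tk) = t by rewrite addrC subrK.
  by rewrite /segment /= tE.
have mG : measurable G.
  have -> : G = \bigcup_(j in `I_k) B j by apply/seteqP; split.
  by apply: fin_bigcup_measurable => //; exact: finite_II.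
have GE : G `<=` Ex `|` Ew.
  move=> w /GB[j /= jk [t /andP[jt tj] exc]].
  apply: contrapT => nE.
  have nEx : ~ Ex w by move=> h; apply: nE; left.
  have nEw : ~ Ew w by move=> h; apply: nE; right.
  have stay := bem_stays tau0 mono_f xi_r M0 bemX (ltW r0) (ltW eps0) Kf0 Kg0
    (ltW rho_gt0) kM HKf HKg _ (HEw w nEw).
  have t0 : 0 <= t by apply: le_trans jt; rewrite mulr_ge0// ltW.
  have t_delta : t <= delta.
    apply: le_trans tk_delta; apply: le_trans tj _.
    by rewrite ler_wpM2r ?(ltW D_gt0)// ler_nat.
  have small : k%:R * (D * Kf + Kg * rho) <= eps.
    have h1 : k%:R * Kf * D <= eps / 2.
      apply: (@le_trans _ _ ((k%:R * Kf + 1) * (eps / c))).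
        by apply: ler_pM => //; [exact: mulr_ge0|exact: ltW|rewrite lerDl].
      rewrite /c le_eqVlt; apply/orP; left; apply/eqP; field.
      by rewrite gt_eqF// ltr_wpDl// mulr_ge0.
    have h2 : k%:R * Kg * rho <= eps / 2.
      apply: (@le_trans _ _ ((k%:R * Kg + 1) * rho)).
        by rewrite ler_wpM2r ?(ltW rho_gt0)// lerDl.
      rewrite /rho /c' le_eqVlt; apply/orP; left; apply/eqP; field.
      by rewrite gt_eqF// ltr_wpDl// mulr_ge0.
    have -> : k%:R * (D * Kf + Kg * rho) = k%:R * Kf * D + k%:R * Kg * rho.
      by ring.
    by rewrite [leRHS](splitr eps); exact: lerD.
  have far : enorm (Y j t w) <= eps10.
    apply: le_trans (enorm_le_trans _ (xi 0) _) _.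
    have -> : eps10 = eps + eps by rewrite /eps; lra.
    apply: lerD.
      apply: bem_affine_bound => //; first by rewrite jt.
        by apply: stay => //; exact: ltnW.
      exact: stay.
    by rewrite enorm_distrC; apply: HEx => //; rewrite t0.
  by move: exc; rewrite ltNge far.
have mU := measurableU _ _ mEx mEw.
apply: (@le_lt_trans _ _ (P (Ex `|` Ew))).
  by apply: le_measure; rewrite ?inE.
apply: le_lt_trans (measureU2 _ mEx mEw) _.
apply: (@le_lt_trans _ _ (eta + eta)%:E); last by rewrite lte_fin /eta; lra.
rewrite EFinD; apply: leeD => //; apply: le_trans PEw _; rewrite lee_fin.
apply: (@le_trans _ _ ((b + 1) * D)); last first.
  by move: D3; rewrite ler_pdivlMr// mulrC.
apply: (@le_trans _ _ (b * D)); last by rewrite ler_wpM2r ?lerDl// ltW.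
by rewrite /b le_eqVlt; apply/orP; left; apply/eqP; ring.
Qed.
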